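(* Let $\eta\in\{132,213,231,312\}$. (i) Let $2\le k\le n$ and define $\tau^*(\eta)\in S_k^{\text{av}(\eta)}$ by $\tau^*(\eta)=k\cdots 1$ (the decreasing permutation of $[k]$) if $\eta=231$ or $\eta=312$, and $\tau^*(\eta)=1\cdots k$ (the increasing permutation) if $\eta=132$ or $\eta=213$. For $\tau\in S_k^{\text{av}(\eta)}$, $$E_n^{\text{av}(\eta)}N_n^{(k;\tau)}=\begin{cases}\dfrac{(n-k+2)C_{n-k+1}}{2C_n}, & \text{if } \tau\neq\tau^*(\eta);\\[2mm] \dfrac{(n-k+3)C_{n-k+2}}{2C_n}-\dfrac{(n-k+2)C_{n-k+1}}{C_n}, & \text{if } \tau=\tau^*(\eta).\end{cases}$$ Also, for fixed $k\ge 2$ and $\tau\in S_k^{\text{av}(\eta)}$, $$\lim_{n\to\infty}\frac{N_n^{(k;\tau)}}{E_n^{\text{av}(\eta)}N_n^{(k;\tau)}}=1\ \text{ in probability}$$ (with respect to the measures $P_n^{\text{av}(\eta)}$). (ii) For $2\le k\le n$, $$E_n^{\text{av}(\eta)}N_n^{(k)}=\frac{C_{n-k+1}}{2C_n}\Big((n-k+2)C_k+n-k\Big).$$ Also, for fixed $k\ge2$, $$\lim_{n\to\infty}\frac{N_n^{(k)}}{E_n^{\text{av}(\eta)}N_n^{(k)}}=1\ \text{ in probability}$$ (with respect to the measures $P_n^{\text{av}(\eta)}$).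
   Context: $S_n$ is the set of permutations $\sigma=\sigma_1\cdots\sigma_n$ of $[n]=\{1,\dots,n\}$. A permutation $\sigma\in S_n$ contains $\eta\in S_m$ ($m\le n$) as a pattern if there are indices $1\le i_1<\cdots<i_m\le n$ such that for all $1\le j,k\le m$, $\sigma_{i_j}<\sigma_{i_k}$ if and only if $\eta_j<\eta_k$; otherwise $\sigma$ avoids $\eta$. $S_n^{\text{av}(\eta)}$ is the set of $\sigma\in S_n$ avoiding $\eta$ (and $S_n^{\text{av}(\eta)}=S_n$ if $n<m$). $P_n^{\text{av}(\eta)}$ is the uniform probability measure on $S_n^{\text{av}(\eta)}$ and $E_n^{\text{av}(\eta)}$ is the corresponding expectation. For $2\le k\le n$, $\tau\in S_k^{\text{av}(\eta)}$ and $\sigma\in S_n^{\text{av}(\eta)}$, $N_n^{(k;\tau)}(\sigma)$ is the number of occurrences of $k$ consecutive numbers appearing in $k$ consecutive positions of $\sigma$ in the order given by $\tau$, i.e. the number of pairs $(l,m)$ with $1\le l,m\le n-k+1$ such that $\{l,l+1,\dots,l+k-1\}=\{\sigma_m,\dots,\sigma_{m+k-1}\}$ and $\tau_i=\sigma_{m+i-1}-(l-1)$ for $i=1,\dots,k$. Further, $N_n^{(k)}(\sigma)=\sum_{\tau\in S_k^{\text{av}(\eta)}}N_n^{(k;\tau)}(\sigma)$. $C_n=\frac1{n+1}\binom{2n}{n}$ is the $n$th Catalan number. *)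

(* Defs.v *)
From mathcomp Require Import all_boot all_order all_algebra all_fingroup.
From mathcomp Require Import all_classical all_reals all_analysis.
Set Implicit Arguments.
Unset Strict Implicit.
Unset Printing Implicit Defensive.
Import Order.TTheory GRing.Theory Num.Theory.
Import numFieldNormedType.Exports.
Local Open Scope ring_scope.

(* A permutation s : 'S_n acts on 'I_n = {0, ..., n-1}, so positions
   and values are shifted down by one with respect to [n] = {1, ..., n};
   one_line is the usual 1-based word s_1 ... s_n. *)
Definition one_line n (s : 'S_n) : seq nat :=
  [seq (s i : nat).+1 | i <- enum 'I_n].

Definition contains m n (eta : 'S_m) (s : 'S_n) : bool :=
  [exists i : {ffun 'I_m -> 'I_n},
     [forall j : 'I_m, forall k : 'I_m, (j < k)%N ==> (i j < i k)%N] &&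
     [forall j : 'I_m, forall k : 'I_m, (s (i j) < s (i k))%N == (eta j < eta k)%N]].

Definition avoiders m (eta : 'S_m) n : {set 'S_n} :=
  [set s | ~~ contains eta s].

(* The pairs (l, m) are 0-based; 'I_(n.+1 - k) is {0, ..., n-k}, and is empty
   when n < k. The index j ranges over positions, so that s j at j = m + i is
   the (m + i)-th letter of s. *)
Definition occurrences k n (tau : 'S_k) (s : 'S_n) : nat :=
  #|[set lm : 'I_(n.+1 - k) * 'I_(n.+1 - k) |
      ([set v : 'I_n | (lm.1 <= v < lm.1 + k)%N]
         == [set s j | j : 'I_n & (lm.2 <= j < lm.2 + k)%N]) &&
      [forall i : 'I_k, forall j : 'I_n,
         (j == lm.2 + i :> nat)%N ==> (s j == lm.1 + tau i :> nat)%N]]|.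

Definition occurrences_all m (eta : 'S_m) k n (s : 'S_n) : nat :=
  (\sum_(tau in avoiders eta k) occurrences tau s)%N.

Definition prob_av (R : realType) m (eta : 'S_m) n (A : {set 'S_n}) : R :=
  #|avoiders eta n :&: A|%:R / #|avoiders eta n|%:R.

Definition expect_av (R : realType) m (eta : 'S_m) n (X : 'S_n -> R) : R :=
  \sum_(s : 'S_n) prob_av R eta [set s] * X s.

Definition cvg_in_prob_av (R : realType) m (eta : 'S_m)
    (X : forall n, 'S_n -> R) (c : R) : Prop :=
  forall eps : R, 0 < eps ->
    (prob_av R eta [set s : 'S_n | eps < `|X n s - c|] @[n --> \oo] --> 0)%classic.

Definition catalan (R : realType) n : R := n.+1%:R^-1 * 'C(n.*2, n)%:R.

Definition tau_star (eta : 'S_3) k : 'S_k :=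
  if one_line eta \in [:: [:: 2; 3; 1]; [:: 3; 1; 2]]%N
  then perm (@rev_ord_inj k) else 1%g.

(* Main.v *)
Require Import Defs.
From mathcomp Require Import all_boot all_order all_algebra all_fingroup.
From mathcomp Require Import all_classical all_reals all_analysis.
From mathcomp Require Import zify ring lra.
Set Implicit Arguments.
Unset Strict Implicit.
Unset Printing Implicit Defensive.
Import Order.TTheory GRing.Theory Num.Theory.
Import numFieldNormedType.Exports.

(** Reversal and inversion permute the four patterns and carry occurrences of
    a block to occurrences of its image, so it suffices to treat 231.

    An occurrence of [t], of size [d.+1], at position [p] of a word of size
    [m + d] can be contracted to a single letter; conversely the letter at
    position [p] of a word [w] of size [m] can be inflated into a copy of [t].
    If [w] and [t] avoid 231, the inflated word can only contain a 231 whose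
    letters 2 and 3 lie in the block and whose letter 1 comes later in [w].
    Hence it avoids 231 iff [t] is decreasing or the inflated letter is a
    right-to-left minimum of [w] ([inflate_avoids]).  So the total number of
    occurrences of [t] over the 231-avoiders of size [m + d] is the sum over the
    231-avoiders [w] of size [m] of the number of admissible letters, which is
    [m] or [rlmins w] ([sum_nocc]).

    A nonempty 231-avoider is [L], then its maximum, then [R], with every letter
    of [L] below every letter of [R]; this gives the Catalan recursion and
    [rlmins = rlmins L + rlmins R + (R is empty)].  The centred variable
    [2 rlmins - (n + 1)] is therefore additive along the decomposition, up to
    boundary terms at the empty words which cancel in the mean.  So its mean
    vanishes for [n > 0], and its cross terms contribute at most [0], which
    bounds its variance by [n + 1] ([sum_rldev], [sum_rldev_sq]).  The mean of
    [rlmins] is thus [(n + 1) / 2], and the formulas for the expectations follow.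

    For the laws of large numbers, count pairs of occurrences by inflating only
    once: inflating a letter raises the number of occurrences by at most a
    constant ([nocc_inflate]), so the second moment at size [m + d] is at most
    the sum over [w] of size [m] of (number of admissible letters) times
    (number of occurrences in [w] + constant).  The first factor concentrates at
    its mean, so the second moment is asymptotically the square of the first
    one as soon as [C_(m - d) C_(m + d) / C_m ^ 2] tends to [1], which holds
    because [C_(n + 1) / C_n] tends to [4]; Chebyshev's inequality concludes
    ([prob_occurrences_le]).  For the total over all blocks, a deviation of the
    sum forces a deviation of one of the finitely many terms. *)

Local Open Scope nat_scope.

(** * Words, avoidance and occurrences *)
Notation "w `@[ i ]" := (nth 0 w i)
  (at level 1, i at level 200, left associativity, format "w `@[ i ]").

(** A permutation of size [n] is handled as the word of its values, shifted to
    [0, ..., n - 1]; the pointwise form leaves all later verifications to linear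
    arithmetic. *)
Definition isperm n (w : seq nat) :=
  [/\ size w = n,
      forall i, i < n -> w`@[i] < n
    & forall i j, i < n -> j < n -> w`@[i] = w`@[j] -> i = j].

Lemma ispermP n w : reflect (isperm n w) (perm_eq w (iota 0 n)).
Proof.
apply: (iffP idP) => [pw|[sw bw iw]].
  have sw : size w = n by rewrite (perm_size pw) size_iota.
  have uw : uniq w by rewrite (perm_uniq pw) iota_uniq.
  split=> // [i lin|i j lin ljn e].
    have : w`@[i] \in w by rewrite mem_nth ?sw.
    by rewrite (perm_mem pw) mem_iota.
  by apply/eqP; rewrite -(nth_uniq 0 _ _ uw) ?sw // e.
have uw : uniq w.
  by apply/(uniqP 0) => i j; rewrite !inE sw; apply: iw.
have sub : {subset w <= iota 0 n}.
  by move=> x /(nthP 0)[i]; rewrite sw => lin <-; rewrite mem_iota /= bw.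
apply: uniq_perm => //; first exact: iota_uniq.
by have [] := uniq_min_size uw sub; rewrite ?size_iota ?sw.
Qed.

Lemma isperm_onto n w v : isperm n w -> v < n -> exists2 i, i < n & w`@[i] = v.
Proof.
move=> /ispermP pw ltvn; have : v \in w by rewrite (perm_mem pw) mem_iota.
by move=> /(nthP 0)[i]; rewrite (perm_size pw) size_iota; exists i.
Qed.

Definition avoids231 (w : seq nat) : bool :=
  `[< forall i j l, i < j -> j < l -> l < size w ->
        w`@[l] < w`@[i] -> w`@[i] < w`@[j] -> False >].

Definition avwords n := [seq w <- permutations (iota 0 n) | avoids231 w].

Definition decreasing (t : seq nat) : bool := sorted gtn t.

Definition rlmin (w : seq nat) p : bool := all (leq w`@[p]) (drop p.+1 w).

(** The offset [l] is determined by [p] once [t] is nonempty, so counting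
    positions amounts to counting the pairs (offset, position). *)
Definition occurs (t w : seq nat) p : bool :=
  `[< exists l, forall i, i < size t ->
        p + i < size w /\ w`@[p + i] = l + t`@[i] >].

Definition nocc t w := \sum_(0 <= p < size w) occurs t w p.

Definition rlmins (w : seq nat) := \sum_(0 <= p < size w) rlmin w p.

(** The letters of a 231-avoider that may be inflated into [t] without creating
    a 231: see [inflate_avoids]. *)
Definition fits (t w : seq nat) p : bool := decreasing t || rlmin w p.

Lemma avwordsP n w : reflect (isperm n w /\ avoids231 w) (w \in avwords n).
Proof.
rewrite mem_filter mem_permutations andbC.
by apply: (iffP andP) => -[/ispermP].
Qed.

Lemma avwords_uniq n : uniq (avwords n).
Proof. exact/filter_uniq/permutations_uniq. Qed.

Lemma size_avword n w : w \in avwords n -> size w = n.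
Proof. by case/avwordsP => -[]. Qed.

Lemma avoids231P w :
  reflect (forall i j l, i < j -> j < l -> l < size w ->
        w`@[l] < w`@[i] -> w`@[i] < w`@[j] -> False) (avoids231 w).
Proof. exact: asboolP. Qed.

Lemma rlminP w p :
  reflect (forall l, p < l -> l < size w -> w`@[p] <= w`@[l]) (rlmin w p).
Proof.
apply: (iffP (all_nthP 0)) => H.
  move=> l pl lw; have := H (l - p.+1).
  by rewrite nth_drop size_drop subnKC //; apply; rewrite ltn_sub2r //; lia.
move=> i; rewrite size_drop nth_drop => Hi; apply: H; lia.
Qed.

Lemma decreasingP t :
  reflect (forall i j, i < j -> j < size t -> t`@[j] < t`@[i]) (decreasing t).
Proof.
have gtT : transitive gtn by move=> y x z /=; lia.
apply: (iffP idP) => [/(sorted_ltn_nth gtT 0) H i j ij jt|H].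
  by apply: H; rewrite ?inE //; lia.
apply/(sortedP 0) => i Hi; exact: H.
Qed.

(** * Inflating a letter into a block *)
Section Inflation.
Variable d : nat.

Definition bump_above x y := if x < y then y + d else y.

Definition collapse p i := if i < p then i else if i <= p + d then p else i - d.

(** [collapse p] sends a position of the inflated word to the position of [w] it
    comes from; the block occupies the [d.+1] positions over [p], and the values
    above that of the inflated letter are shifted by [d]. *)
Definition inflate (t : seq nat) p (w : seq nat) :=
  mkseq (fun i => if (p <= i <= p + d) then w`@[p] + t`@[i - p]
                  else bump_above w`@[p] w`@[collapse p i]) (size w + d).

Variables (t : seq nat) (m p : nat).
Hypotheses (pt : isperm d.+1 t) (ltpm : p < m).

Lemma size_inflate w : size (inflate t p w) = size w + d.
Proof. by rewrite size_mkseq. Qed.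

Lemma inflateE w i : i < size w + d ->
  (inflate t p w)`@[i] = if (p <= i <= p + d) then w`@[p] + t`@[i - p]
                  else bump_above w`@[p] w`@[collapse p i].
Proof. by move=> ?; rewrite nth_mkseq. Qed.

Lemma inflate_block w i : isperm m w -> i <= d ->
  (inflate t p w)`@[p + i] = w`@[p] + t`@[i].
Proof.
case=> sw _ _ id; rewrite inflateE; last by rewrite sw; lia.
by rewrite ifT ?addKn //; lia.
Qed.

(** Comparing two letters of the inflated word that do not both lie in the
    block amounts to comparing their images under [collapse]; everything about
    patterns of the inflated word is read off from this. *)
Lemma inflate_lt w i j : isperm m w -> i < m + d -> j < m + d ->
  collapse p i != collapse p j ->
  ((inflate t p w)`@[i] < (inflate t p w)`@[j]) =
  (w`@[collapse p i] < w`@[collapse p j]).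
Proof.
case=> sw bw iw li lj ne; rewrite !inflateE ?sw //.
case: pt => st bt it.
have ci : collapse p i < m by rewrite /collapse; do ?case: ifP; lia.
have cj : collapse p j < m by rewrite /collapse; do ?case: ifP; lia.
have Ip := iw _ _ ci ltpm; have Jp := iw _ _ cj ltpm.
have IJ := iw _ _ ci cj.
have Ti := bt (i - p); have Tj := bt (j - p).
move: Ip Jp IJ Ti Tj ne; rewrite /bump_above /collapse.
case: (ltnP i p) => ip; case: (ltnP j p) => jp.
- rewrite /=; do ?case: ifP; lia.
- case: (leqP j (p + d)) => jpd; rewrite /=; do ?case: ifP; lia.
- case: (leqP i (p + d)) => ipd; rewrite /=; do ?case: ifP; lia.
- case: (leqP i (p + d)) => ipd; case: (leqP j (p + d)) => jpd;
  rewrite /=; do ?case: ifP; lia.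
Qed.

Lemma inflate_isperm w : isperm m w -> isperm (m + d) (inflate t p w).
Proof.
move=> pw; have [sw bw iw] := pw; have [st bt it] := pt.
split; first by rewrite size_inflate sw.
  move=> i li; rewrite inflateE ?sw //.
  have ci : collapse p i < m by rewrite /collapse; do ?case: ifP; lia.
  have B1 := bw _ ci; have B2 := bw _ ltpm; have B3 := bt (i - p).
  rewrite /bump_above; case: ifP => [h|_]; first by lia.
  by case: ifP; lia.
move=> i j li lj e.
have ci : collapse p i < m by rewrite /collapse; do ?case: ifP; lia.
have cj : collapse p j < m by rewrite /collapse; do ?case: ifP; lia.
have [ce|cne] := eqVneq (collapse p i) (collapse p j).
  have [bi|nbi] := boolP (p <= i <= p + d); last first.
    by move: nbi ce; rewrite /collapse; do ?case: ifP; lia.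
  have bj : p <= j <= p + d.
    by move: bi ce; rewrite /collapse; do ?case: ifP; lia.
  move: e; rewrite !inflateE ?sw // bi bj => /addnI /it; lia.
have H1 := inflate_lt pw li lj cne.
rewrite eq_sym in cne; have H2 := inflate_lt pw lj li cne.
by move: H1 H2; rewrite e ltnn => H1 H2; have := iw _ _ ci cj; move: cne; lia.
Qed.

Lemma inflate_occurs w : isperm m w -> occurs t (inflate t p w) p.
Proof.
move=> pw; apply/asboolP; exists w`@[p] => i; case: (pt) => -> _ _ li.
by rewrite inflate_block // size_inflate; case: pw => -> _ _; split=> //; lia.
Qed.

Lemma inflate_inj w1 w2 : isperm m w1 -> isperm m w2 ->
  inflate t p w1 = inflate t p w2 -> w1 = w2.
Proof.
move=> pw1 pw2 e; have [s1 b1 i1] := pw1; have [s2 b2 i2] := pw2.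
have ep : w1`@[p] = w2`@[p].
  have : (inflate t p w1)`@[p + 0] = (inflate t p w2)`@[p + 0] by rewrite e.
  by rewrite !inflate_block // => /addIn.
apply: (@eq_from_nth _ 0); rewrite ?s1 ?s2 // => i li.
have [->//|nip] := eqVneq i p.
pose j := if i < p then i else i + d.
have lj : j < m + d by rewrite /j; case: ifP; lia.
have cj : collapse p j = i by rewrite /collapse /j; do ?case: ifP; lia.
have bj : (p <= j <= p + d) = false by rewrite /j; case: ifP; lia.
have : (inflate t p w1)`@[j] = (inflate t p w2)`@[j] by rewrite e.
rewrite !inflateE ?s1 ?s2 // bj cj -ep /bump_above.
by do ?case: ifP; lia.
Qed.

(** Contraction: the values of the block form an interval because [t] is onto, so
    every other letter lies below or above the whole block, and pushing the upper
    ones down by [d] yields the preimage. *)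
Lemma inflate_onto w : isperm (m + d) w -> occurs t w p ->
  exists2 w', isperm m w' & w = inflate t p w'.
Proof.
move=> pw /asboolP[l Hl]; have [sw bw iw] := pw; have [st bt it] := pt.
have blk i : i <= d -> w`@[p + i] = l + t`@[i] by move=> id; have [] := Hl i; lia.
pose lift i := if i <= p then i else i + d.
(* A letter outside the block takes no value of the block. *)
have out i : i < m -> i != p -> w`@[lift i] < l \/ l + d < w`@[lift i].
  move=> lim nip; case: (ltnP w`@[lift i] l) => [|h1]; [by left|right].
  rewrite ltnNge; apply/negP => h2.
  have [|a la ea] := isperm_onto (v := w`@[lift i] - l) pt; first by lia.
  move: ea h1 h2; have := iw (p + a) (lift i); rewrite blk // /lift.
  by case: ifP => *; lia.
pose v i := if i == p then l else if w`@[lift i] < l then w`@[lift i]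
            else w`@[lift i] - d.
have vE i : i < m -> (mkseq v m)`@[i] = v i by move=> ?; rewrite nth_mkseq.
have l_le : l + d < m + d.
  have [a la ea] := isperm_onto (v := d) pt (ltnSn d).
  have := bw (p + a); rewrite blk ?ea; lia.
have liftlt i : i < m -> lift i < m + d by rewrite /lift; case: ifP; lia.
have pw' : isperm m (mkseq v m).
  split; first by rewrite size_mkseq.
    move=> i lim; rewrite vE // /v; have [_|nip] := eqVneq i p; first by lia.
    by have := bw _ (liftlt _ lim); have := out i lim nip; case: ifP; lia.
  move=> i j lim ljm; rewrite !vE // /v.
  have := iw (lift i) (lift j) (liftlt _ lim) (liftlt _ ljm).
  have [->|nip] := eqVneq i p; have [->|njp] := eqVneq j p => //.
  - by have := out j ljm njp; do ?case: ifP; lia.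
  - by have := out i lim nip; do ?case: ifP; lia.
  have := out i lim nip; have := out j ljm njp => Oj Oi inj.
  have lij : lift i = lift j -> i = j by rewrite /lift; do ?case: ifP; lia.
  move=> e; apply/lij/inj; move: e; do ?case: ifP; lia.
exists (mkseq v m) => //.
have sw' : size (mkseq v m) = m by rewrite size_mkseq.
apply: (@eq_from_nth _ 0) => [|i]; first by rewrite size_inflate sw' sw.
rewrite sw => li; rewrite inflateE ?sw' // !vE ?ltpm //; last first.
  by rewrite /collapse; do ?case: ifP; lia.
have -> : v p = l by rewrite /v eqxx.
case: ifP => [bi|nbi]; first by rewrite -blk ?subnKC //; lia.
have [cm cp] : collapse p i < m /\ collapse p i != p.
  by rewrite /collapse; move: nbi; do ?case: ifP; lia.
have e : lift (collapse p i) = i.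
  by rewrite /lift /collapse; move: nbi; do ?case: ifP; lia.
have := out _ cm cp; rewrite /v (negPf cp) e /bump_above.
by do ?case: ifP; lia.
Qed.

(** A new 231 uses exactly two letters of the block, and these are consecutive
    both in position and in value relative to the third one.  The third letter
    is hence neither the 2, which lies between the others in value, nor the 3,
    which lies between them in position: it is the 1, the block has an ascent,
    and a smaller letter follows the block. *)
Lemma inflate_avoids w : isperm m w -> avoids231 t ->
  avoids231 (inflate t p w) = avoids231 w && fits t w p.
Proof.
move=> pw avt; have [sw bw iw] := pw; have [st bt it] := pt.
have csub i j : i <= j -> collapse p i <= collapse p j.
  by rewrite /collapse; do ?case: ifP; lia.
have cblk i : p <= i <= p + d -> collapse p i = p.
  by rewrite /collapse; do ?case: ifP; lia.
pose lift i := if i <= p then i else i + d.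
have cl i : collapse p (lift i) = i.
  by rewrite /lift /collapse; do ?case: ifP; lia.
have liftlt i : i < m -> lift i < m + d by rewrite /lift; case: ifP; lia.
have liftm i j : i < j -> lift i < lift j by rewrite /lift; do ?case: ifP; lia.
have clt i : i < m + d -> collapse p i < m.
  by rewrite /collapse; do ?case: ifP; lia.
apply/avoids231P/andP.
  rewrite size_inflate sw => av; split.
    apply/avoids231P => i j l ij jl; rewrite sw => lm wli wij.
    have [ij' jl'] := (liftm _ _ ij, liftm _ _ jl).
    apply: (av _ _ _ ij' jl'); rewrite ?inflate_lt ?cl //; try apply: liftlt; lia.
  rewrite /fits; case: (boolP (decreasing t)) => //= /decreasingP ndec.
  apply/rlminP => l pl; rewrite sw => lm; rewrite leqNgt; apply/negP => wl.
  apply: ndec => i j ij; rewrite st => jd; rewrite ltnNge leq_eqVlt negb_or.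
  apply/andP; split.
    by apply/eqP => /it; lia.
  apply/negP => tij.
  apply: (av (p + i) (p + j) (lift l)).
  - by lia.
  - by rewrite /lift; case: ifP; lia.
  - exact: liftlt.
  - rewrite inflate_lt //; rewrite ?cl ?cblk ?liftlt //; lia.
  - by rewrite !inflate_block //; lia.
move=> [/avoids231P av fit] i j l ij jl; rewrite size_inflate sw => lm.
move=> wli wij.
have cij := csub _ _ (ltnW ij); have cjl := csub _ _ (ltnW jl).
have blk a b : a < b -> collapse p a = collapse p b ->
    (p <= a <= p + d) /\ (p <= b <= p + d).
  by rewrite /collapse; do ?case: ifP; lia.
have lim : i < m + d by lia.
have ljm : j < m + d by lia.
(* The 2 and the 3 both lie in the block. *)
case: (eqVneq (collapse p i) (collapse p j)) => [eij|nij].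
  have [bi bj] := blk _ _ ij eij.
  have ei : i = p + (i - p) by lia.
  have ej : j = p + (j - p) by lia.
  case: (eqVneq (collapse p j) (collapse p l)) => [ejl|njl].
    have [_ bl] := blk _ _ jl ejl.
    have el : l = p + (l - p) by lia.
    move: wli wij; rewrite ei ej el !inflate_block //; try lia.
    move=> h1 h2; move/avoids231P: avt => /(_ (i - p) (j - p) (l - p)).
    by rewrite st; apply; lia.
  move: wli; rewrite inflate_lt ?eij // 1?eq_sym // => wli.
  move: wij; rewrite ei ej !inflate_block //; try lia; move=> tij.
  case/orP: fit => [/decreasingP dec|/rlminP rl].
    by have := dec (i - p) (j - p); rewrite st; lia.
  have := rl (collapse p l); rewrite sw clt //.
  by move: cjl wli njl; rewrite (cblk j bj) //; lia.
(* The 3 and the 1 both lie in the block. *)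
case: (eqVneq (collapse p j) (collapse p l)) => [ejl|njl].
  move: wli wij; rewrite !inflate_lt // -?ejl //; last by rewrite eq_sym.
  by lia.
apply: (av (collapse p i) (collapse p j) (collapse p l)); rewrite ?sw.
- by lia.
- by lia.
- exact: clt.
- by rewrite -inflate_lt //; lia.
- by rewrite -inflate_lt.
Qed.

End Inflation.

(** * Counting occurrences by inflation *)
Lemma noccE m d t w : size t = d.+1 -> size w = m + d ->
  nocc t w = \sum_(0 <= p < m) occurs t w p.
Proof.
move=> st sw; rewrite /nocc sw (@big_cat_nat _ _ _ m) //=; last exact: leq_addr.
rewrite [X in _ + X]big_nat [X in _ + X]big1 ?addn0 // => p /andP[mp _].
case: (boolP (occurs t w p)) => // /asboolP[l] /(_ d).
by rewrite st sw ltnSn => /(_ isT)[]; lia.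
Qed.

(** For each position [p], inflation at [p] is a bijection from the 231-avoiders
    of size [m] whose letter at [p] fits onto those of size [m + d] in which [t]
    occurs at [p].  Taking [F = 1] gives the first moment of [nocc t], taking
    [F = nocc t] the second one. *)
Lemma sum_occurs m d t (F : seq nat -> nat) : t \in avwords d.+1 ->
  \sum_(w <- avwords (m + d)) nocc t w * F w =
  \sum_(w <- avwords m) \sum_(0 <= p < m) fits t w p * F (inflate d t p w).
Proof.
case/avwordsP => pt avt; have [st _ _] := pt.
transitivity (\sum_(w <- avwords (m + d)) \sum_(0 <= p < m) occurs t w p * F w).
  apply: eq_big_seq => w /size_avword sw.
  by rewrite (noccE st sw) big_distrl.
rewrite exchange_big [RHS]exchange_big /=; apply: eq_big_nat => p /andP[_ ltpm].
have filt (b : pred (seq nat)) G s :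
    \sum_(w <- s) b w * G w = \sum_(w <- [seq w <- s | b w]) G w.
  by rewrite big_filter [RHS]big_mkcond; apply: eq_bigr => w _; case: (b w); lia.
rewrite (filt (occurs t ^~ p)) (filt (fits t ^~ p) (fun w => F (inflate d t p w))).
rewrite -(big_map (inflate d t p) predT F); apply: perm_big.
apply: uniq_perm; first exact/filter_uniq/avwords_uniq.
  rewrite map_inj_in_uniq; first exact/filter_uniq/avwords_uniq.
  move=> w1 w2; rewrite mem_filter [w2 \in _]mem_filter.
  move=> /andP[_ /avwordsP[p1 _]] /andP[_ /avwordsP[p2 _]].
  exact: inflate_inj ltpm _ _ p1 p2.
move=> w; rewrite mem_filter; apply/andP/mapP.
  case=> oc /avwordsP[pw avw]; have [w' pw' e] := inflate_onto pt ltpm pw oc.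
  exists w' => //; move: avw; rewrite e (inflate_avoids pt ltpm) // => /andP[a f].
  by rewrite mem_filter f; apply/avwordsP.
case=> w'; rewrite mem_filter => /andP[f /avwordsP[pw' av']] ->.
split; first exact: (inflate_occurs pt ltpm pw').
apply/avwordsP; split; first exact: (inflate_isperm pt ltpm pw').
by rewrite (inflate_avoids pt ltpm) // av'.
Qed.

Lemma sum_fits t m w : size w = m ->
  \sum_(0 <= p < m) fits t w p = if decreasing t then m else rlmins w.
Proof.
move=> sw; rewrite /fits /rlmins sw; case: (decreasing t) => //=.
by rewrite sum_nat_const_nat subn0 muln1.
Qed.

Lemma sum_nocc m d t : t \in avwords d.+1 ->
  \sum_(w <- avwords (m + d)) nocc t w =
  \sum_(w <- avwords m) if decreasing t then m else rlmins w.
Proof.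
move=> tT; transitivity (\sum_(w <- avwords (m + d)) nocc t w * 1).
  by apply: eq_bigr => w _; rewrite muln1.
rewrite (sum_occurs _ (fun=> 1) tT); apply: eq_big_seq => w /size_avword sw.
by rewrite -(sum_fits _ sw); apply: eq_bigr => p _; rewrite muln1.
Qed.

Lemma sum_bool_le (b : nat -> bool) i j : \sum_(i <= q < j) b q <= j - i.
Proof.
rewrite -[leqRHS]muln1 -sum_nat_const_nat.
by apply: leq_sum => p _; apply: leq_b1.
Qed.

Lemma nocc_le t w : nocc t w <= size w.
Proof. by rewrite /nocc -[leqRHS]subn0 sum_bool_le. Qed.

(** An occurrence that does not meet the block comes from one in [w]: its values
    form an interval disjoint from that of the block, hence lie on one side of
    it, and stay an interval after contraction.  At most [(2 * d).+1] positions
    meet the block. *)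
Lemma nocc_inflate m d t p w : isperm d.+1 t -> isperm m w -> p < m ->
  nocc t (inflate d t p w) <= nocc t w + (2 * d).+1.
Proof.
move=> pt pw ltpm; have [st bt it] := pt; have [sw bw iw] := pw.
(* The letter 0 of [t] locates the bottom of an interval of values, which tells
   whether the interval lies above the block and was shifted by [d]. *)
have [i0 li0 ti0] := isperm_onto (v := 0) pt isT.
have low q : q + d < p -> occurs t (inflate d t p w) q -> occurs t w q.
  move=> qp /asboolP[l Hl]; apply/asboolP.
  have wE i : i <= d -> w`@[q + i] != w`@[p] /\
      bump_above d w`@[p] w`@[q + i] = l + t`@[i].
    move=> id; have := Hl i; rewrite st size_inflate sw.
    case=> // liq; rewrite inflateE ?sw //.
    have -> : (p <= q + i <= p + d) = false by lia.
    have -> : collapse d p (q + i) = q + i by rewrite /collapse ifT //; lia.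
    by split=> //; apply/eqP => /iw; lia.
  have w0 := wE _ li0.
  exists (if l < w`@[p] then l else l - d) => i; rewrite st => li.
  rewrite sw; split; first by lia.
  have wi := wE _ li; have ti := bt _ li.
  by move: w0 wi; rewrite ti0 /bump_above; do ?case: ifP; lia.
have high q : p < q -> occurs t (inflate d t p w) (q + d) -> occurs t w q.
  move=> pq /asboolP[l Hl]; apply/asboolP.
  have wE i : i <= d -> [/\ q + i < m, w`@[q + i] != w`@[p] &
      bump_above d w`@[p] w`@[q + i] = l + t`@[i]].
    move=> id; have := Hl i; rewrite st size_inflate sw.
    case=> // liq; rewrite inflateE ?sw //.
    have -> : (p <= q + d + i <= p + d) = false by lia.
    have -> : collapse d p (q + d + i) = q + i.
      by rewrite /collapse; do ?case: ifP; lia.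
    by split=> //; [lia|apply/eqP => /iw; lia].
  have w0 := wE _ li0.
  exists (if l < w`@[p] then l else l - d) => i; rewrite st => li.
  rewrite sw; have [H wi ei] := wE _ li; split=> //; have ti := bt _ li.
  by case: w0; move: wi ei; rewrite ti0 /bump_above; do ?case: ifP; lia.
rewrite {1}/nocc size_inflate sw.
rewrite (@big_cat_nat _ _ _ (p - d) 0 (m + d)) //=; last by lia.
(* Only occurrences starting between [p - d] and [p + d] can meet the block;
   their number is bounded by that of these positions. *)
rewrite (@big_cat_nat _ _ _ (p + d).+1 (p - d) (m + d)) //=; [|lia|lia].
rewrite -addSn (big_addn p.+1 (m + d) d) addnK.
rewrite /nocc sw (@big_cat_nat _ _ _ (p - d) 0 m) //=; last by lia.
rewrite (@big_cat_nat _ _ _ p.+1 (p - d) m) //=; last by lia.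
have H1 : \sum_(0 <= q < p - d) occurs t (inflate d t p w) q <=
          \sum_(0 <= q < p - d) occurs t w q.
  rewrite big_nat [leqRHS]big_nat; apply: leq_sum => q /andP[_ lq].
  by have := low q; case: occurs; case: occurs => //; lia.
have H2 := sum_bool_le (occurs t (inflate d t p w)) (p - d) (p + d).+1.
have H3 : \sum_(p.+1 <= q < m) occurs t (inflate d t p w) (q + d) <=
          \sum_(p.+1 <= q < m) occurs t w q.
  rewrite big_nat [leqRHS]big_nat; apply: leq_sum => q /andP[lq _].
  by have := high q; case: occurs; case: occurs => //; lia.
by rewrite addSn; lia.
Qed.

(** The pairs of occurrences are counted by inflating a single letter and using
    that the other occurrences are, up to a constant, those of the shorter word. *)
Lemma sum_nocc_sq m d t : t \in avwords d.+1 ->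
  \sum_(w <- avwords (m + d)) nocc t w ^ 2 <=
  \sum_(w <- avwords m)
     (if decreasing t then m else rlmins w) * (nocc t w + (2 * d).+1).
Proof.
move=> tT; have /avwordsP[pt _] := tT.
have -> : \sum_(w <- avwords (m + d)) nocc t w ^ 2 =
          \sum_(w <- avwords (m + d)) nocc t w * nocc t w by [].
rewrite (sum_occurs _ (nocc t) tT) big_seq [leqRHS]big_seq.
apply: leq_sum => w /avwordsP[pw _]; have [sw _ _] := pw.
rewrite -(sum_fits t sw) big_distrl /= big_nat [leqRHS]big_nat.
apply: leq_sum => p /andP[_ lp]; rewrite leq_mul2l; apply/orP; right.
exact: nocc_inflate pt pw lp.
Qed.

(** * Cutting a 231-avoider at its maximum *)
Definition glue (L R : seq nat) :=
  L ++ (size L + size R) :: map (addn (size L)) R.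

Section Glue.
Variables (i j : nat) (L R : seq nat).
Hypotheses (pL : isperm i L) (pR : isperm j R).

Let sL : size L = i. Proof. by case: pL. Qed.
Let sR : size R = j. Proof. by case: pR. Qed.
Let bL a : a < i -> L`@[a] < i. Proof. by case: pL => _ + _; apply. Qed.
Let bR a : a < j -> R`@[a] < j. Proof. by case: pR => _ + _; apply. Qed.

Lemma size_glue : size (glue L R) = (i + j).+1.
Proof. by rewrite size_cat /= size_map addnS sL sR. Qed.

Let gL a : a < i -> (glue L R)`@[a] = L`@[a].
Proof. by move=> h; rewrite nth_cat sL h. Qed.

Lemma glue_max : (glue L R)`@[i] = i + j.
Proof. by rewrite nth_cat sL ltnn subnn /= sR. Qed.

Let gR a : a < j -> (glue L R)`@[i.+1 + a] = i + R`@[a].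
Proof.
move=> h; rewrite nth_cat sL ifF; last by lia.
have -> : i.+1 + a - i = a.+1 by lia.
by rewrite /= (nth_map 0) ?sR.
Qed.

Let gP a : a < (i + j).+1 ->
  [\/ a < i, a = i | exists2 b, b < j & a = i.+1 + b].
Proof.
move=> h; case: (ltngtP a i) => c.
- by constructor 1.
- by constructor 3; exists (a - i.+1); lia.
- by constructor 2.
Qed.

Lemma glue_isperm : isperm (i + j).+1 (glue L R).
Proof.
split; first exact: size_glue.
  move=> a /gP[ai|->|[b bj ->]].
  - by rewrite gL //; have := bL ai; lia.
  - by rewrite glue_max; lia.
  - by rewrite gR //; have := bR bj; lia.
move=> a b /gP[ai|->|[a' aj ->]] /gP[bi|->|[b' bj ->]];
  rewrite ?gR ?glue_max ?gL //.
- by case: pL => _ _; apply.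
- by have := bL ai; lia.
- by have := bL ai; lia.
- by have := bL bi; lia.
- by have := bR bj; lia.
- by have := bL bi; lia.
- by have := bR aj; lia.
- by move=> /addnI e; case: pR => _ _ /(_ _ _ aj bj e) ->.
Qed.

Lemma glue_avoids : avoids231 (glue L R) = avoids231 L && avoids231 R.
Proof.
apply/avoids231P/andP.
  rewrite size_glue => av; split; apply/avoids231P => a b c ab bc.
    rewrite sL => ci H1 H2; apply: (av a b c ab bc); rewrite ?gL //; lia.
  rewrite sR => ci H1 H2.
  by apply: (av (i.+1 + a) (i.+1 + b) (i.+1 + c)); rewrite ?gR //; lia.
case=> /avoids231P avL /avoids231P avR a b c ab bc.
rewrite size_glue => ci.
have lb : b < (i + j).+1 by lia.
have la : a < (i + j).+1 by lia.
move: ab bc; case: (gP la) => [ai|->|[a' aj ->]];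
  case: (gP lb) => [bi|->|[b' bj ->]]; case: (gP ci) => [ci'|->|[c' cj ->]];
  rewrite ?gR ?glue_max ?gL // => ab bc; try lia.
- by apply: (avL a b c); rewrite ?sL.
- by have := bL ai; lia.
- by have := bL ai; lia.
- by have := bL ai; lia.
- by have := bL ai; lia.
- by have := bR bj; lia.
- have a'b' : a' < b' by lia.
  have b'c' : b' < c' by lia.
  by have := avR a' b' c' a'b' b'c'; rewrite sR => /(_ cj); lia.
Qed.

(** The letters of [L] only compete among themselves, since all others are
    larger, and the maximum is a right-to-left minimum only in last position. *)
Lemma rlmins_glue : rlmins (glue L R) = rlmins L + rlmins R + (j == 0).
Proof.
rewrite /rlmins size_glue sL sR.
rewrite (@big_cat_nat _ _ _ i 0 (i + j).+1) //=; last by lia.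
rewrite [X in _ + X]big_ltn; last by lia.
rewrite addnCA [RHS]addnC; congr (_ + (_ + _)).
- congr (nat_of_bool _); apply/rlminP/eqP => [H|j0 l].
    apply/eqP; rewrite -leqn0 leqNgt; apply/negP => j0.
    have := H i.+1 (ltnSn _); rewrite size_glue glue_max.
    have := gR j0; rewrite addn0 => ->; have := bR j0; lia.
  by rewrite size_glue; lia.
- apply: eq_big_nat => p /andP[_ pi]; congr (nat_of_bool _).
  apply/rlminP/rlminP => H l pl.
    by rewrite sL => li; have := H l pl; rewrite size_glue !gL //; apply; lia.
  rewrite size_glue => /gP[li|->|[b bj ->]]; rewrite gL //.
  - by rewrite gL //; apply: H; rewrite ?sL.
  - by rewrite glue_max; have := bL pi; lia.
  - by rewrite gR //; have := bL pi; lia.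
- rewrite -{1}[i.+1]add0n big_addn.
  have -> : (i + j).+1 - i.+1 = j by lia.
  apply: eq_big_nat => p /andP[_ pj]; congr (nat_of_bool _).
  rewrite addnC; apply/rlminP/rlminP => H l pl.
    rewrite sR => lj; have := H (i.+1 + l); rewrite size_glue !gR //; lia.
  rewrite size_glue => /gP[li|?|[b bj ?]]; [by lia|by lia|subst l].
  rewrite !gR // leq_add2l; apply: H; rewrite ?sR //; lia.
Qed.
End Glue.

Lemma glue_inj i j i' j' L R L' R' : isperm i L -> isperm j R ->
  isperm i' L' -> isperm j' R' -> i + j = i' + j' ->
  glue L R = glue L' R' -> L = L' /\ R = R'.
Proof.
move=> pL pR pL' pR' eij e.
have [_ _ inj] := glue_isperm pL pR.
have ei : i = i'.
  apply: inj; [lia|lia|]; rewrite (glue_max pL pR) e (glue_max pL' pR').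
  exact: eij.
have [sL _ _] := pL; have [sL' _ _] := pL'.
move/eqP: e; rewrite /glue eqseq_cat; last by rewrite sL sL'.
case/andP=> /eqP eL /eqP[_ eR]; split=> //.
by move: eR; rewrite eL; apply: (inj_map (@addnI _)).
Qed.

(** Letters before the maximum are smaller than those after it, else they would
    form a 231 with it; so the letters of [L] are the smallest ones. *)
Lemma glue_onto n w : isperm n.+1 w -> avoids231 w ->
  exists i L R, [/\ i <= n, L \in avwords i, R \in avwords (n - i) & w = glue L R].
Proof.
move=> pw av; have [sw bw iw] := pw.
have [i lin wi] := isperm_onto pw (ltnSn n).
set L := take i w; set M := drop i.+1 w.
have sL : size L = i by rewrite size_takel // sw ltnW.
have sM : size M = n - i by rewrite size_drop sw subSS.
have wE : w = L ++ n :: M.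
  by rewrite -{1}(cat_take_drop i w) (drop_nth 0) ?sw // wi.
have pLM : perm_eq (L ++ M) (iota 0 n).
  have /ispermP := pw; rewrite wE -addn1 iotaD /= add0n => H.
  have : perm_eq (n :: (L ++ M)) (n :: iota 0 n).
    apply: perm_trans (perm_trans H _); last by rewrite perm_catC.
    by rewrite -cat1s perm_catCA.
  by rewrite perm_cons.
have ltLM : allrel leq L M.
  apply/allrelP => x y /(nthP 0)[a]; rewrite sL => ai <-.
  move=> /(nthP 0)[b]; rewrite sM => bj <-.
  rewrite nth_take // nth_drop leqNgt; apply/negP => lt.
  have := avoids231P _ av a i (i.+1 + b) ai; rewrite wi sw; apply=> //; try lia.
  have := bw a; have := iw a i; lia.
(* Sorting each side sorts the whole word, which identifies the letters of
   each side. *)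
have eLM : sort leq L ++ sort leq M = iota 0 n.
  apply: (sorted_eq leq_trans anti_leq); last 2 first.
  - exact: iota_sorted.
  - by apply: perm_trans pLM; apply: perm_cat; rewrite perm_sort.
  rewrite (sorted_pairwise leq_trans) pairwise_cat -!(sorted_pairwise leq_trans).
  rewrite !(sort_sorted leq_total) !andbT.
  by apply/allrelP => x y; rewrite !mem_sort; move/allrelP: ltLM; apply.
have lin' : i <= n by lia.
have pL : perm_eq L (iota 0 i).
  rewrite -(perm_sort leq).
  have := congr1 (take i) eLM; rewrite take_size_cat ?size_sort // => ->.
  by rewrite take_iota (minn_idPl lin').
have pM : perm_eq M (iota i (n - i)).
  rewrite -(perm_sort leq).
  have := congr1 (drop i) eLM; rewrite drop_size_cat ?size_sort // => ->.
  by rewrite drop_iota add0n.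
pose R := map (subn^~ i) M.
have MR : M = map (addn i) R.
  rewrite -map_comp -[LHS]map_id; apply/eq_in_map => x /=.
  by rewrite (perm_mem pM) mem_iota /= => ?; lia.
have pR : perm_eq R (iota 0 (n - i)).
  apply: (perm_map_inj (@addnI i)).
  by rewrite -MR -iotaDl addn0.
have sR : size R = n - i by rewrite size_map.
have wg : w = glue L R by rewrite /glue sL sR subnKC // -MR.
move/ispermP in pL; move/ispermP in pR.
have := glue_avoids pL pR; rewrite -wg av => /esym/andP[avL avR].
by exists i, L, R; split=> //; apply/avwordsP.
Qed.

Lemma sum_avwords_glue (V : nmodType) n (F : seq nat -> V) :
  (\sum_(w <- avwords n.+1) F w =
   \sum_(i < n.+1) \sum_(L <- avwords i) \sum_(R <- avwords (n - i)) F (glue L R))%R.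
Proof.
pose f (i : nat) (z : seq nat * seq nat) := glue z.1 z.2.
pose T (i : nat) := [seq (L, R) | L <- avwords i, R <- avwords (n - i)].
have mT i z : z \in T i -> [/\ isperm i z.1, isperm (n - i) z.2,
    z.1 \in avwords i & z.2 \in avwords (n - i)].
  case/allpairsP=> -[L R] /= [hL hR ->]; split=> //=.
    by case/avwordsP: hL.
  by case/avwordsP: hR.
have pE : perm_eq (avwords n.+1) [seq f i z | i <- iota 0 n.+1, z <- T i].
  apply: uniq_perm; first exact: avwords_uniq.
    apply: allpairs_uniq_dep; first exact: iota_uniq.
      move=> i _; apply: allpairs_uniq; try exact: avwords_uniq.
      by move=> [? ?] [? ?] _ _ [-> ->].
    move=> [i z] [i' z'] /allpairsPdep[a [za [ia Hz e]]].
    move=> /allpairsPdep[a' [za' [ia' Hz' e']]].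
    case: e Hz => -> /= <-{za} Hz; case: e' Hz' => -> /= <-{za'} Hz'.
    rewrite /f /= => e.
    have [p1 p2 _ _] := mT _ _ Hz; have [p1' p2' _ _] := mT _ _ Hz'.
    have [|e1 e2] := glue_inj p1 p2 p1' p2' _ e.
      by move: ia ia'; rewrite !mem_iota; lia.
    have ez : z = z' by case: (z) (z') e1 e2 => [? ?] [? ?] /= -> ->.
    have ei : a = a' by case: p1 p1' => <- _ _ [<- _ _]; rewrite e1.
    by rewrite ez ei.
  move=> w; apply/idP/allpairsPdep.
    case/avwordsP=> pw av; have [i [L [R [lin hL hR ->]]]] := glue_onto pw av.
    exists i, (L, R); split=> //; first by rewrite mem_iota /= add0n ltnS.
    by apply/allpairsP; exists (L, R).
  case=> i [z [Hi Hz ->]]; have [p1 p2 h1 h2] := mT _ _ Hz.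
  have lin : i + (n - i) = n by move: Hi; rewrite mem_iota; lia.
  apply/avwordsP; split; first by rewrite -lin; apply: glue_isperm.
  rewrite (glue_avoids p1 p2).
  by case/avwordsP: h1 => _ ->; case/avwordsP: h2.
rewrite (perm_big _ pE) big_allpairs_dep -[iota 0 n.+1]/(index_iota 0 n.+1) big_mkord.
apply: eq_bigr => i _.
by rewrite /T big_allpairs.
Qed.

(** * Catalan numbers *)
Definition avcount n := size (avwords n).

Lemma avwords0 : avwords 0 = [:: [::]].
Proof. by rewrite /avwords /=; case: avoids231P => // -[] //. Qed.

Lemma avcountS n : avcount n.+1 = \sum_(i < n.+1) avcount i * avcount (n - i).
Proof.
rewrite /avcount -sum1_size (sum_avwords_glue n (fun=> 1)).
apply: eq_bigr => i _.
rewrite -[in RHS]sum1_size big_distrl /=; apply: eq_bigr => L _.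
by rewrite mul1n sum1_size.
Qed.

(** Reversing the summation replaces [i] by [n - i], so the average weight is
    [n + a]. *)
Lemma sum_avcount_affine n a :
  \sum_(i < n.+1) (2 * i + a) * (avcount i * avcount (n - i)) = (n + a) * avcount n.+1.
Proof.
have sym : \sum_(i < n.+1) i * (avcount i * avcount (n - i)) =
           \sum_(i < n.+1) (n - i) * (avcount i * avcount (n - i)).
  rewrite (reindex_inj rev_ord_inj) /=; apply: eq_bigr => i _.
  by rewrite subSS subKn; [rewrite [avcount _ * _]mulnC|rewrite -ltnS].
rewrite avcountS big_distrr /=.
transitivity (\sum_(i < n.+1) (i + (n - i) + a) * (avcount i * avcount (n - i))).
  under eq_bigr do rewrite mul2n -addnn !mulnDl.
  under [RHS]eq_bigr do rewrite !mulnDl.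
  by rewrite !big_split /= {2}sym.
by apply: eq_bigr => i _; rewrite subnKC // -ltnS.
Qed.

(** By [sum_avcount_affine], [n.+3 * c_n.+2] is the sum over [i <= n.+1] of
    [(2 * i + 2) * (c_i * c_(n.+1 - i))].  Splitting off [i = 0] and applying the
    induction hypothesis to [i.+2 * c_i.+1] in the other terms leaves a sum of the
    same kind over [i <= n], which [sum_avcount_affine] evaluates again. *)
Lemma avcount_rec n : n.+2 * avcount n.+1 = (4 * n + 2) * avcount n.
Proof.
have avcount0 : avcount 0 = 1 by rewrite /avcount avwords0.
elim/ltn_ind: n => -[_|n IH].
  by rewrite avcountS big_ord1 avcount0.
have := sum_avcount_affine n.+1 2; rewrite addn2 => <-.
rewrite big_ord_recl /= muln0 add0n avcount0 subn0 mul1n.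
transitivity (2 * avcount n.+1 + \sum_(i < n.+1) 2 * ((4 * i + 2) * avcount i * avcount (n - i))).
  congr (_ + _); apply: eq_bigr => i _.
  rewrite /bump /= add1n subSS -(IH i) //; lia.
transitivity (2 * avcount n.+1 + 4 * \sum_(i < n.+1) (2 * i + 1) * (avcount i * avcount (n - i))).
  congr (_ + _); rewrite big_distrr; apply: eq_bigr => i _; rewrite /=; lia.
by rewrite sum_avcount_affine; lia.
Qed.

Lemma bin_avcount n : 'C(n.*2, n) = n.+1 * avcount n.
Proof.
elim: n => [|n IH]; first by rewrite /avcount avwords0.
have H1 : n.*2.+1 * 'C(n.*2, n) = n.+1 * 'C(n.*2.+1, n).
  by rewrite (mul_bin_down n.*2.+1 n); congr (_ * _); lia.
have H2 := mul_bin_diag n.*2.+2 n.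
rewrite doubleS avcount_rec; apply/eqP.
rewrite -(eqn_pmul2l (ltn0Sn n)) -(eqn_pmul2l (ltn0Sn n)) -H2 /=; apply/eqP.
by rewrite mulnCA -H1 IH; lia.
Qed.

Lemma avcount_gt0 n : 0 < avcount n.
Proof.
by rewrite -(@ltn_pmul2l n.+1) // muln0 -bin_avcount bin_gt0 -addnn leq_addr.
Qed.

Local Open Scope ring_scope.

(** * Right-to-left minima: mean and variance *)
Section RlminMoments.
Variable R : realDomainType.

(** Twice the deviation of [rlmins] from its mean [n.+1 / 2]. *)
Definition rldev n (w : seq nat) : R := (2 * rlmins w)%:R - n.+1%:R.

(** The contribution of the right factor; the term for the empty word accounts
    for the maximum being a right-to-left minimum. *)
Definition rldev_right n (w : seq nat) : R :=
  rldev n w + (if n == 0%N then 2 else 0).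

Lemma rldev_glue i j L M : isperm i L -> isperm j M ->
  rldev (i + j).+1 (glue L M) = rldev i L + rldev_right j M.
Proof.
move=> pL pM; rewrite /rldev_right /rldev (rlmins_glue pL pM).
rewrite !natrM !natrD -!natr1 natrD.
by case: (j == 0%N) => /=; ring.
Qed.

Lemma sum_avwords_rldev n (F : R -> R) :
  \sum_(w <- avwords n.+1) F (rldev n.+1 w) =
  \sum_(i < n.+1) \sum_(L <- avwords i) \sum_(M <- avwords (n - i))
    F (rldev i L + rldev_right (n - i) M).
Proof.
rewrite (sum_avwords_glue n (F \o rldev n.+1)); apply: eq_bigr => i _.
apply: eq_big_seq => L /avwordsP[pL _]; apply: eq_big_seq => M /avwordsP[pM _].
by rewrite /= -rldev_glue // subnKC // -ltnS.
Qed.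

Lemma sum_const_avwords n (c : R) : \sum_(w <- avwords n) c = (avcount n)%:R * c.
Proof.
by rewrite big_const_seq count_predT iter_addr_0 mulr_natl.
Qed.

Lemma rldev_nil : rldev 0 [::] = -1.
Proof. by rewrite /rldev /rlmins big_geq // muln0 sub0r. Qed.

Lemma sum_rldev_right n :
  \sum_(w <- avwords n) rldev n w = - (n == 0%N)%:R ->
  \sum_(w <- avwords n) rldev_right n w = (n == 0%N)%:R.
Proof.
move=> H; rewrite big_split sum_const_avwords /= H.
by case: eqP => [->|_]; rewrite /avcount ?avwords0 /=; ring.
Qed.

Lemma sum_rldev_right_sq n :
  \sum_(w <- avwords n) rldev_right n w ^+ 2 =
  \sum_(w <- avwords n) rldev n w ^+ 2.
Proof.
case: n => [|n]; last by apply: eq_bigr => w _; rewrite /rldev_right addr0.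
by rewrite avwords0 !big_seq1 /rldev_right rldev_nil; ring.
Qed.

(** By induction only the splittings with an empty factor contribute; an empty
    left factor contributes [-1] and an empty right factor [-1 + 2 = 1], and these
    cancel. *)
Lemma sum_rldev n : \sum_(w <- avwords n) rldev n w = - (n == 0%N)%:R.
Proof.
elim/ltn_ind: n => -[_|n IH]; first by rewrite avwords0 big_seq1 rldev_nil.
rewrite (sum_avwords_rldev _ id) /= oppr0.
transitivity (\sum_(i < n.+1)
   ((avcount (n - i))%:R * - ((i : nat) == 0%N)%:R
    + (avcount i)%:R * ((n - i)%N == 0%N)%:R) : R).
  apply: eq_bigr => i _; have lin := ltn_ord i.
  have IHj : (n - i < n.+1)%N by lia.
  under eq_bigr do rewrite big_split sum_const_avwords sum_rldev_right ?IH //=.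
  by rewrite big_split /= -big_distrr /= sum_const_avwords IH.
rewrite big_split /= big_ord_recl [X in _ + X]big_ord_recr /= subn0 subnn.
rewrite !big1 ?eqxx ?addr0 ?add0r; first by rewrite mulrN1 mulr1 addNr.
  by move=> i _; rewrite (_ : (n - i == 0)%N = false) ?mulr0 //=; have := ltn_ord i; lia.
by move=> i _; rewrite oppr0 mulr0.
Qed.

Lemma sum_sqr_add i j (a b : seq nat -> R) :
  \sum_(L <- avwords i) \sum_(M <- avwords j) (a L + b M) ^+ 2 =
    (avcount j)%:R * (\sum_(L <- avwords i) a L ^+ 2) +
    2 * ((\sum_(L <- avwords i) a L) * (\sum_(M <- avwords j) b M)) +
    (avcount i)%:R * (\sum_(M <- avwords j) b M ^+ 2).
Proof.
transitivity (\sum_(L <- avwords i) ((avcount j)%:R * a L ^+ 2 +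
     2 * (a L * \sum_(M <- avwords j) b M) + \sum_(M <- avwords j) b M ^+ 2)).
  apply: eq_bigr => L _; under eq_bigr do rewrite sqrrD.
  rewrite !big_split /= sum_const_avwords; congr (_ + _ + _).
  by rewrite mulr_sumr mulr_natl mulr2n.
by rewrite !big_split /= sum_const_avwords -!mulr_sumr -mulr_suml.
Qed.

(** The cross terms of the expanded square vanish, except for two empty
    factors where they are negative; the remaining terms satisfy the same
    recursion as [n.+1 * c_n]. *)
Lemma sum_rldev_sq n :
  \sum_(w <- avwords n) rldev n w ^+ 2 <= n.+1%:R * (avcount n)%:R.
Proof.
elim/ltn_ind: n => -[_|n IH].
  by rewrite avwords0 big_seq1 rldev_nil /avcount avwords0 mulr1 sqrrN expr1n.
rewrite (sum_avwords_rldev _ (fun x => x ^+ 2)).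
have -> : n.+2%:R * (avcount n.+1)%:R =
    \sum_(i < n.+1) n.+2%:R * ((avcount i)%:R * (avcount (n - i))%:R) :> R.
  rewrite avcountS natr_sum big_distrr; apply: eq_bigr => i _.
  by rewrite natrM.
apply: ler_sum => i _; have lin := ltn_ord i.
have IHj : (n - i < n.+1)%N by lia.
rewrite sum_sqr_add.
rewrite sum_rldev sum_rldev_right ?sum_rldev // sum_rldev_right_sq.
have H1 := IH _ lin; have H2 := IH _ IHj.
have c1 := ler0n R (avcount i); have c2 := ler0n R (avcount (n - i)).
have H3 : n.+2%:R = i.+1%:R + (n - i).+1%:R :> R.
  by rewrite -natrD; congr (_%:R); lia.
rewrite H3; set z := 2 * _.
have z0 : z <= 0 by rewrite /z mulNr mulrN oppr_le0 !mulr_ge0.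
have K1 := ler_wpM2l c2 H1; have K2 := ler_wpM2l c1 H2.
apply: le_trans (lerD (lerD K1 z0) K2) _.
by rewrite le_eqVlt; apply/orP; left; apply/eqP; ring.
Qed.

End RlminMoments.

Local Open Scope nat_scope.

(** * From permutations to words *)
Definition word n (s : 'S_n) : seq nat := [seq val (s i) | i <- enum 'I_n].

Lemma size_word n (s : 'S_n) : size (word s) = n.
Proof. by rewrite size_map size_enum_ord. Qed.

Lemma nth_word n (s : 'S_n) (i : 'I_n) : (word s)`@[i] = s i.
Proof. by rewrite (nth_map i) ?size_enum_ord // nth_ord_enum. Qed.

Lemma word_inj n : injective (@word n).
Proof.
move=> s1 s2 e; apply/permP => i; apply: val_inj.
by rewrite /= -(nth_word s1) -(nth_word s2) e.
Qed.

Lemma word_isperm n (s : 'S_n) : isperm n (word s).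
Proof.
split=> [|i lin|i j lin ljn]; first exact: size_word.
  by rewrite (nth_word s (Ordinal lin)).
rewrite (nth_word s (Ordinal lin)) (nth_word s (Ordinal ljn)).
by move=> /val_inj /perm_inj [].
Qed.

Lemma word_onto n w : isperm n w -> exists s : 'S_n, word s = w.
Proof.
move=> [sw bw iw]; pose f (i : 'I_n) := Ordinal (bw i (ltn_ord i)).
have f_inj : injective f.
  by move=> i j [] /iw e; apply: val_inj; apply: e.
exists (perm f_inj); apply: (@eq_from_nth _ 0); rewrite size_word ?sw //.
by move=> i lin; rewrite (nth_word _ (Ordinal lin)) permE.
Qed.

Lemma sum_word (V : nmodType) n (P : pred (seq nat)) (F : seq nat -> V) :
  (\sum_(s : 'S_n | P (word s)) F (word s) =
   \sum_(w <- permutations (iota 0 n) | P w) F w)%R.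
Proof.
rewrite -(big_map (@word n) P F) /=; apply: perm_big; apply: uniq_perm.
- by rewrite map_inj_uniq ?index_enum_uniq //; apply: word_inj.
- exact: permutations_uniq.
move=> w; rewrite mem_permutations; apply/mapP/ispermP.
  by case=> s _ ->; apply: word_isperm.
by case/word_onto => s <-; exists s; rewrite ?mem_index_enum.
Qed.

Definition occurs_at k n (tau : 'S_k) (s : 'S_n) (l m : nat) : bool :=
  [forall i : 'I_k, forall j : 'I_n,
     (j == m + i :> nat) ==> (s j == l + tau i :> nat)].

Lemma occurs_atP k n (tau : 'S_k) (s : 'S_n) l m :
  reflect (forall (i : 'I_k) (j : 'I_n), j = m + i :> nat ->
             s j = l + tau i :> nat) (occurs_at tau s l m).
Proof.
apply: (iffP forallP) => [H i j e|H i].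
  by have /forallP/(_ j) := H i; rewrite e eqxx => /eqP.
by apply/forallP => j; apply/implyP => /eqP e; apply/eqP/H.
Qed.

(** Since [tau] is onto, the pointwise condition implies the equality of the two
    sets of values. *)
Lemma occurrencesE k n (tau : 'S_k) (s : 'S_n) :
  occurrences tau s = #|[set lm : 'I_(n.+1 - k) * 'I_(n.+1 - k) |
                          occurs_at tau s lm.1 lm.2]|.
Proof.
congr #|pred_of_set _|; apply/setP => -[l m]; rewrite !inE /=.
apply: andb_idl => /occurs_atP H; apply/eqP/setP => v; rewrite inE.
have lm := ltn_ord m.
apply/idP/imsetP => [/andP[lv vl]|[j]].
  have vk : v - l < k by lia.
  have jn : m + (tau^-1%g (Ordinal vk)) < n.
    by have := ltn_ord (tau^-1%g (Ordinal vk)); lia.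
  exists (Ordinal jn); first by rewrite inE /=; have := ltn_ord (tau^-1%g (Ordinal vk)); lia.
  apply: val_inj; rewrite /= (H (tau^-1%g (Ordinal vk))) // permKV /=; lia.
rewrite inE => /andP[mj jm] ->.
have jk : j - m < k by lia.
rewrite (H (Ordinal jk)) /=; last by lia.
by have := ltn_ord (tau (Ordinal jk)); lia.
Qed.

Lemma occurrences_word d n (tau : 'S_d.+1) (s : 'S_n) :
  occurrences tau s = nocc (word tau) (word s).
Proof.
rewrite occurrencesE /nocc size_word.
have atE (l m : 'I_(n.+1 - d.+1)) : occurs_at tau s l m <->
    forall i, i < d.+1 -> (word s)`@[m + i] = l + (word tau)`@[i].
  have lm := ltn_ord m.
  split=> [/occurs_atP H i li|H]; last first.
    by apply/occurs_atP => i j e; rewrite -!nth_word e H.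
  have jn : m + i < n by lia.
  rewrite (nth_word tau (Ordinal li)) (nth_word s (Ordinal jn)).
  exact: H.
have occE (m : 'I_(n.+1 - d.+1)) :
   #|[set l : 'I_(n.+1 - d.+1) | occurs_at tau s l m]| =
   occurs (word tau) (word s) m.
  have lm := ltn_ord m.
  have uniq_l (l l' : 'I_(n.+1 - d.+1)) :
      occurs_at tau s l m -> occurs_at tau s l' m -> l = l'.
    move=> /atE/(_ 0 isT) e /atE/(_ 0 isT); rewrite e => /addIn e'.
    exact: val_inj.
  case: (boolP (occurs _ _ m)) => [/asboolP[l]|noc].
    rewrite !size_word => H.
    have [a la ea] := isperm_onto (v := d) (word_isperm tau) (ltnSn d).
    have ln : l < n.+1 - d.+1.
      have [h1 h2] := H _ la; have [_ + _] := word_isperm s.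
      by move=> /(_ _ h1); rewrite h2 ea; lia.
    have ol : occurs_at tau s (Ordinal ln) m.
      by apply/atE => i li; have [] := H _ li.
    apply/eqP/cards1P; exists (Ordinal ln); apply/setP => l'; rewrite !inE.
    by apply/idP/eqP => [ol'|->//]; apply: uniq_l.
  apply/eqP; rewrite cards_eq0; apply/eqP/setP => l; rewrite !inE.
  apply: contraNF noc => /atE H; apply/asboolP; exists l => i.
  by rewrite !size_word => li; split; [lia|apply: H].
rewrite cardsE -sum1_card.
rewrite -(pair_big_dep predT (fun l m => occurs_at tau s (val l) (val m)) (fun _ _ => 1)) /=.
rewrite (exchange_big_dep predT) //=.
transitivity (\sum_(0 <= m < n.+1 - d.+1) occurs (word tau) (word s) m).
  rewrite big_mkord; apply: eq_bigr => m _.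
  by rewrite -occE -sum1_card; apply: eq_bigl => l; rewrite inE.
case: (leqP d.+1 n) => dn.
  rewrite (@big_cat_nat _ _ _ (n.+1 - d.+1) 0 n) //=; last by lia.
  rewrite [X in _ + X]big_nat [X in _ + X]big1 ?addn0 // => p /andP[mp _].
  case: (boolP (occurs _ _ p)) => // /asboolP[l] /(_ d).
  by rewrite !size_word => /(_ (ltnSn _))[]; lia.
rewrite big_geq; last by lia.
rewrite big_nat big1 // => p /andP[_ pn].
case: (boolP (occurs _ _ p)) => // /asboolP[l] /(_ d).
by rewrite !size_word => /(_ (ltnSn _))[]; lia.
Qed.

Lemma containsP m n (eta : 'S_m) (s : 'S_n) :
  reflect (exists i : 'I_m -> 'I_n, (forall j k : 'I_m, j < k -> i j < i k) /\
             (forall j k : 'I_m, (s (i j) < s (i k)) = (eta j < eta k)))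
          (contains eta s).
Proof.
apply: (iffP existsP) => -[i].
  case/andP=> /forallP H1 /forallP H2; exists i; split=> j k.
    by move: (H1 j) => /forallP/(_ k)/implyP.
  by move: (H2 j) => /forallP/(_ k)/eqP.
case=> H1 H2; exists [ffun j => i j]; apply/andP; split.
  apply/forallP => j; apply/forallP => k; apply/implyP; rewrite !ffunE.
  exact: H1.
by apply/forallP => j; apply/forallP => k; rewrite !ffunE H2.
Qed.

Lemma one_line3 (eta : 'S_3) : one_line eta =
  [:: (eta ord0 : nat).+1; (eta (lift ord0 ord0) : nat).+1;
      (eta (lift ord0 (lift ord0 ord0)) : nat).+1].
Proof. by rewrite /one_line !enum_ordSl (size0nil (size_enum_ord 0)). Qed.

Lemma avoiders_word (eta : 'S_3) n (s : 'S_n) : one_line eta = [:: 2; 3; 1] ->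
  (s \in avoiders eta n) = avoids231 (word s).
Proof.
rewrite one_line3 => -[e0 e1 e2]; rewrite inE.
apply/idP/avoids231P => [nc a b c ab bc|av].
  rewrite size_word => cn H1 H2; move/negP: nc; apply; apply/containsP.
  have bn : b < n by lia.
  have an : a < n by lia.
  exists (fun j : 'I_3 => nth (Ordinal an) [:: Ordinal an; Ordinal bn; Ordinal cn] j).
  move: H1 H2; rewrite (nth_word s (Ordinal an)) (nth_word s (Ordinal bn)).
  rewrite (nth_word s (Ordinal cn)) => {}H1 {}H2.
  have all3 (P : 'I_3 -> Prop) : P ord0 -> P (lift ord0 ord0) ->
      P (lift ord0 (lift ord0 ord0)) -> forall j, P j.
    move=> p0 p1 p2 j.
    have [->//|[->//|->//]] : j = ord0 \/ j = lift ord0 ord0 \/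
        j = lift ord0 (lift ord0 ord0).
    case: j => -[|[|[|//]]] h; [left|right;left|right;right]; exact: val_inj.
  by split; do 2!apply: (all3 (fun j => _)); rewrite /= ?e0 ?e1 ?e2 //=; lia.
apply/negP => /containsP[i [H1 H2]].
apply: (av (i ord0) (i (lift ord0 ord0)) (i (lift ord0 (lift ord0 ord0)))).
- exact: H1.
- exact: H1.
- by rewrite size_word.
- by rewrite !nth_word H2 e0 e2.
- by rewrite !nth_word H2 e0 e1.
Qed.

(** * Reversal and inversion *)
Definition rev_perm n : 'S_n := perm (@rev_ord_inj n).

(** The counting problem for [eta] is the one for 231: each [tau] has a
    counterpart [t] with the same distribution of occurrences, and [tstar] is the
    one whose counterpart is decreasing. *)
Definition modelled (eta : 'S_3) (tstar : forall k, 'S_k) : Prop :=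
  (forall k, tstar k \in avoiders eta k) /\
  forall d (tau : 'S_d.+1), tau \in avoiders eta d.+1 ->
    exists2 t, t \in avwords d.+1 /\ decreasing t = (tau == tstar d.+1) &
      forall (V : nmodType) n (F : nat -> V),
        (\sum_(s in avoiders eta n) F (occurrences tau s) =
         \sum_(w <- avwords n) F (nocc t w))%R.

Lemma word_rev_perm k : decreasing (word (rev_perm k)).
Proof.
apply/decreasingP => i j ij; rewrite size_word => jk.
have ik : i < k by lia.
rewrite (nth_word _ (Ordinal ik)) (nth_word _ (Ordinal jk)) !permE /=; lia.
Qed.

Lemma decreasing_word k (tau : 'S_k) :
  decreasing (word tau) = (tau == rev_perm k).
Proof.
apply/idP/eqP => [dec|->]; last exact: word_rev_perm.
have gt_tr : transitive gtn by move=> y x z /= h1 h2; lia.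
have gt_as : antisymmetric gtn by move=> x y /= /andP[]; lia.
apply: word_inj; apply: (sorted_eq gt_tr gt_as dec (word_rev_perm k)).
have /ispermP H := word_isperm tau; apply: perm_trans H _.
by rewrite perm_sym; apply/ispermP/word_isperm.
Qed.

Lemma modelled_231 eta : one_line eta = [:: 2; 3; 1] -> modelled eta rev_perm.
Proof.
move=> e; split=> [k|d tau].
  rewrite (avoiders_word _ e); apply/avoids231P => i j l ij jl lk _.
  have /decreasingP/(_ i j ij) := word_rev_perm k; lia.
rewrite (avoiders_word _ e) => av; exists (word tau).
  split; last exact: decreasing_word.
  by apply/avwordsP; split=> //; apply: word_isperm.
move=> V n F; under eq_bigl do rewrite (avoiders_word _ e).
under eq_bigr do rewrite occurrences_word.
by rewrite (sum_word n avoids231 (fun w => F (nocc (word tau) w))) big_filter.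
Qed.

(** Reindexing the sums along [op]; the converse of the preservation of
    containment follows from involutivity. *)
Lemma modelled_op (op : forall n, 'S_n -> 'S_n) eta tstar :
  (forall n, involutive (@op n)) ->
  (forall m n (mu : 'S_m) (s : 'S_n), contains mu s -> contains (op _ mu) (op _ s)) ->
  (forall k n (tau : 'S_k) (s : 'S_n),
      occurrences (op _ tau) (op _ s) = occurrences tau s) ->
  modelled eta tstar -> modelled (op _ eta) (fun k => op _ (tstar k)).
Proof.
move=> opK cont occ [starA mod].
have avE n (s : 'S_n) : (op _ s \in avoiders (op _ eta) n) = (s \in avoiders eta n).
  rewrite !inE; congr (~~ _); apply/idP/idP; last exact: cont.
  by move=> /cont; rewrite !opK.
split=> [k|d tau]; first by rewrite avE.
rewrite -(opK _ tau) avE => /mod[t [tav dec] H]; exists t.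
  by split; rewrite // (inj_eq (can_inj (@opK _))).
move=> V n F; rewrite -H (reindex_inj (can_inj (@opK n))) /=.
by apply: eq_big => s; rewrite ?avE // => _; rewrite occ.
Qed.

Lemma occurrences_le k n (tau tau' : 'S_k) (s s' : 'S_n)
    (f : 'I_(n.+1 - k) * 'I_(n.+1 - k) -> 'I_(n.+1 - k) * 'I_(n.+1 - k)) :
  injective f ->
  (forall l m : 'I_(n.+1 - k), occurs_at tau s l m ->
     occurs_at tau' s' (f (l, m)).1 (f (l, m)).2) ->
  occurrences tau s <= occurrences tau' s'.
Proof.
move=> f_inj H; rewrite !occurrencesE -(card_imset _ f_inj).
apply/subset_leq_card/fintype.subsetP => lm /imsetP[[l m] + ->].
by rewrite !inE; apply: H.
Qed.

Definition reversal n (s : 'S_n) : 'S_n := (rev_perm n * s)%g.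

Lemma reversalE n (s : 'S_n) i : reversal s i = s (rev_ord i).
Proof. by rewrite permM permE. Qed.

Lemma reversalK n : involutive (@reversal n).
Proof. by move=> s; apply/permP => i; rewrite !reversalE rev_ordK. Qed.

Lemma contains_reversal m n (mu : 'S_m) (s : 'S_n) :
  contains mu s -> contains (reversal mu) (reversal s).
Proof.
move=> /containsP[i [H1 H2]]; apply/containsP.
exists (fun j => rev_ord (i (rev_ord j))); split=> j k; last first.
  by rewrite !reversalE rev_ordK rev_ordK H2.
have := ltn_ord j; have := ltn_ord k => km jm jk.
have : i (rev_ord k) < i (rev_ord j) by apply: H1 => /=; lia.
by have := ltn_ord (i (rev_ord j)) => /=; lia.
Qed.

Lemma occurrences_reversal k n (tau : 'S_k) (s : 'S_n) :
  occurrences (reversal tau) (reversal s) = occurrences tau s.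
Proof.
have le (tau1 : 'S_k) (s1 : 'S_n) :
    occurrences tau1 s1 <= occurrences (reversal tau1) (reversal s1).
  apply: (@occurrences_le _ _ _ _ _ _ (fun lm => (lm.1, rev_ord lm.2))).
    move=> [l m] [l' m'] e; have /= e1 := congr1 fst e.
    by have /= /rev_ord_inj e2 := congr1 snd e; rewrite e1 e2.
  move=> l m /occurs_atP H; apply/occurs_atP => i j /= e.
  rewrite !reversalE (H (rev_ord i)) //=.
  by have := ltn_ord m; have := ltn_ord i; lia.
by apply/eqP; rewrite eqn_leq le -{2}[tau]reversalK -{2}[s]reversalK le.
Qed.

Definition inversion n (s : 'S_n) : 'S_n := (s^-1)%g.

(** Exchanging positions and values, an embedding [i] of [mu] into [s] becomes
    the embedding [j |-> s (i (mu^-1 j))] of [mu^-1] into [s^-1]. *)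
Lemma contains_inversion m n (mu : 'S_m) (s : 'S_n) :
  contains mu s -> contains (inversion mu) (inversion s).
Proof.
move=> /containsP[i [H1 H2]]; apply/containsP.
have H1' (j k : 'I_m) : (i j < i k) = (j < k).
  case: (ltngtP j k) => [/H1 ->//|/H1|/val_inj->]; last by rewrite ltnn.
  by case: ltngtP.
exists (fun j => s (i (mu^-1 j)%g)); split=> j k.
  by rewrite H2 !permKV.
by rewrite !permK H1'.
Qed.

Lemma occurrences_inversion k n (tau : 'S_k) (s : 'S_n) :
  occurrences (inversion tau) (inversion s) = occurrences tau s.
Proof.
have le (tau1 : 'S_k) (s1 : 'S_n) :
    occurrences tau1 s1 <= occurrences (inversion tau1) (inversion s1).
  apply: (@occurrences_le _ _ _ _ _ _ (fun lm => (lm.2, lm.1))).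
    move=> [l m] [l' m'] e; have /= e1 := congr1 fst e.
    by have /= e2 := congr1 snd e; rewrite e1 e2.
  move=> l m /occurs_atP H; apply/occurs_atP => i j /= e.
  have li := ltn_ord (tau1^-1 i)%g; have lm := ltn_ord m.
  have bn : m + (tau1^-1 i)%g < n by lia.
  have sb : s1 (Ordinal bn) = j.
    by apply: val_inj; rewrite /= (H (tau1^-1 i)%g) // permKV.
  by rewrite -sb permK.
by apply/eqP; rewrite eqn_leq le -{2}[tau]invgK -{2}[s]invgK le.
Qed.

Lemma modelled_reversal eta tstar : modelled eta tstar ->
  modelled (reversal eta) (fun k => reversal (tstar k)).
Proof.
apply: modelled_op; [exact: reversalK| |exact: occurrences_reversal].
exact: contains_reversal.
Qed.

Lemma modelled_inversion eta tstar : modelled eta tstar ->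
  modelled (inversion eta) (fun k => inversion (tstar k)).
Proof.
apply: modelled_op; [by move=> n s; apply: invgK| |exact: occurrences_inversion].
exact: contains_inversion.
Qed.

Lemma one_line_reversal (eta : 'S_3) : one_line (reversal eta) = rev (one_line eta).
Proof.
rewrite !one_line3 !reversalE.
by do ![congr (_ :: _)]; congr (nat_of_ord (eta _)).+1; apply: val_inj.
Qed.

Lemma one_line_inversion (eta : 'S_3) :
  one_line eta = [:: 3; 1; 2] -> one_line (inversion eta) = [:: 2; 3; 1].
Proof.
rewrite !one_line3 => -[e0 e1 e2].
have f0 : eta ord0 = lift ord0 (lift ord0 ord0) by apply: val_inj.
have f1 : eta (lift ord0 ord0) = ord0 by apply: val_inj.
have f2 : eta (lift ord0 (lift ord0 ord0)) = lift ord0 ord0 by apply: val_inj.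
have g0 : inversion eta ord0 = lift ord0 ord0.
  exact: (canLR (permK eta) (esym f1)).
have g1 : inversion eta (lift ord0 ord0) = lift ord0 (lift ord0 ord0).
  exact: (canLR (permK eta) (esym f2)).
have g2 : inversion eta (lift ord0 (lift ord0 ord0)) = ord0.
  exact: (canLR (permK eta) (esym f0)).
by rewrite g0 g1 g2.
Qed.

Lemma eq_modelled eta (ts ts' : forall k, 'S_k) :
  (forall k, ts k = ts' k) -> modelled eta ts -> modelled eta ts'.
Proof.
move=> e [starA mod]; split=> [k|d tau /mod[t [? ?] ?]]; first by rewrite -e.
by exists t; rewrite -?e.
Qed.

(** 312 is the inverse of 231, and 132 and 213 are the reversals of 231 and 312;
    inversion fixes the decreasing permutation while reversal turns it into the
    identity, in accordance with [tau_star]. *)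
Lemma avoiders_modelled (eta : 'S_3) :
  one_line eta \in
      [:: [:: 1; 3; 2]; [:: 2; 1; 3]; [:: 2; 3; 1]; [:: 3; 1; 2]] ->
  modelled eta (tau_star eta).
Proof.
have inv_rev n : inversion (rev_perm n) = rev_perm n.
  apply/permP => i; apply: (can_inj (permK (rev_perm n))).
  by rewrite permKV !permE rev_ordK.
have rev_rev n : reversal (rev_perm n) = 1%g.
  by apply/permP => i; rewrite reversalE permE rev_ordK perm1.
have m231 (mu : 'S_3) : one_line mu = [:: 2; 3; 1] -> modelled mu (tau_star mu).
  move=> e; apply: eq_modelled (modelled_231 e) => k.
  by rewrite /tau_star e.
have m312 (mu : 'S_3) : one_line mu = [:: 3; 1; 2] -> modelled mu (tau_star mu).
  move=> e; have e' := one_line_inversion e.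
  rewrite -[mu in modelled mu _]invgK -[_^-1%g]/(inversion _).
  apply: eq_modelled (modelled_inversion (m231 _ e')) => k.
  by rewrite /tau_star e e' inv_rev.
have mrev (mu nu : 'S_3) : mu = reversal nu ->
    one_line nu \in [:: [:: 2; 3; 1]; [:: 3; 1; 2]] ->
    modelled nu (tau_star nu) -> modelled mu (tau_star mu).
  move=> -> h mod; apply: eq_modelled (modelled_reversal mod) => k.
  rewrite /tau_star h rev_rev one_line_reversal.
  by move: h; rewrite !inE => /orP[] /eqP ->.
rewrite !inE => /or4P[] /eqP e; [| |exact: m231|exact: m312].
- have e' : one_line (reversal eta) = [:: 2; 3; 1] by rewrite one_line_reversal e.
  by apply: (mrev _ (reversal eta)); rewrite ?reversalK ?e' //; apply: m231.
- have e' : one_line (reversal eta) = [:: 3; 1; 2] by rewrite one_line_reversal e.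
  by apply: (mrev _ (reversal eta)); rewrite ?reversalK ?e' //; apply: m312.
Qed.

Lemma card_avoiders (eta : 'S_3) n tstar : modelled eta tstar -> (0 < n)%N ->
  #|avoiders eta n| = avcount n.
Proof.
case: n => // n [starA mod] _; have [t _ H] := mod 0 _ (starA 1).
by rewrite -sum1_card (H _ n.+1 (fun _ => 1)) sum1_size.
Qed.

Local Open Scope ring_scope.

(** * First and second moments of the occurrence count *)
Section OccurrenceMoments.
Variable R : realType.

Local Notation c n := ((avcount n)%:R : R).

Lemma catalan_avcount n : catalan R n = c n.
Proof. by rewrite /catalan bin_avcount natrM mulKf // pnatr_eq0. Qed.

Lemma avcountR_gt0 n : 0 < c n.
Proof. by rewrite ltr0n avcount_gt0. Qed.

(** The mean over [avwords m] of the number of letters that fit a block, where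
    [dec] tells whether the block is decreasing. *)
Definition nfit_mean (dec : bool) m : R :=
  if dec then m%:R else m.+1%:R / 2.

Lemma sum_nfit t m : (0 < m)%N ->
  \sum_(w <- avwords m) (if decreasing t then m else rlmins w)%:R =
  nfit_mean (decreasing t) m * c m.
Proof.
move=> m0; rewrite /nfit_mean; case: (decreasing t).
  by rewrite sum_const_avwords mulrC.
have := sum_rldev R m; rewrite /rldev big_split sum_const_avwords /=.
have -> : (m == 0%N) = false by lia.
under eq_bigr do rewrite natrM.
rewrite -mulr_sumr oppr0 => /eqP; rewrite mulrN subr_eq0 => /eqP e.
by apply: (mulfI (x := 2)); rewrite ?pnatr_eq0 // e; field.
Qed.

Lemma sum_nocc_mean m d t : t \in avwords d.+1 -> (0 < m)%N ->
  \sum_(w <- avwords (m + d)) (nocc t w)%:R = nfit_mean (decreasing t) m * c m.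
Proof.
by move=> tT m0; rewrite -sum_nfit // -natr_sum (sum_nocc m tT) natr_sum.
Qed.

(** The inequality [2 * `|x| <= h * x ^+ 2 + h^-1] turns the bound on the variance
    into one on the mean absolute deviation; the two terms are balanced by
    [h = m.+1 ^ (- 1 / 2)], for which [h^-1 = h * m.+1]. *)
Lemma sum_abs_rldev m (h : R) : 0 < h -> h ^+ 2 * m.+1%:R = 1 ->
  \sum_(w <- avwords m) `|rldev R m w| <= h * m.+1%:R * c m.
Proof.
move=> h0 h1; have m0 : 0 < m.+1%:R :> R by rewrite ltr0n.
apply: (@le_trans _ _
  (\sum_(w <- avwords m) (h / 2 * rldev R m w ^+ 2 + h / 2 * m.+1%:R))).
  apply: ler_sum => w _; set x := rldev R m w.
  have := sqr_ge0 (h * `|x| - 1); rewrite -(pmulr_rge0 _ (mulr_gt0 m0 h0)).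
  rewrite -[x ^+ 2]real_normK ?num_real // => H.
  have -> : `|x| = h ^+ 2 * m.+1%:R * `|x| by rewrite h1 mul1r.
  rewrite !h1 !mul1r in H *.
  have e : m.+1%:R * h * (h * `|x| - 1) ^+ 2 =
    (h ^+ 2 * m.+1%:R) * h * `|x| ^+ 2 - 2 * (h ^+ 2 * m.+1%:R) * `|x|
    + m.+1%:R * h by ring.
  by move: H; rewrite e h1 => H; lra.
rewrite big_split sum_const_avwords -mulr_sumr /=.
have := sum_rldev_sq R m; set S := \sum_(_ <- _) _ => HS.
have := ler_wpM2l (ltW h0) HS; set K := m.+1%:R; lra.
Qed.

(** The main term is the product of the mean number of fitting letters and of
    the total number of occurrences at size [p + d]; the error terms come from the
    fluctuation of the number of fitting letters, times at most [p + d]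
    occurrences, and from the constant of [nocc_inflate]. *)
Lemma sum_nocc_sq_bound p d t (h : R) : t \in avwords d.+1 -> (0 < p)%N ->
  0 < h -> h ^+ 2 * (p + d).+1%:R = 1 ->
  \sum_(w <- avwords (p + d + d)) (nocc t w)%:R ^+ 2 <=
  nfit_mean (decreasing t) (p + d) ^+ 2 * c p +
  (p + d)%:R * c (p + d) * ((p + d).+1%:R * h / 2 + (2 * d).+1%:R).
Proof.
move=> tT p0 h0 h1; set m := (p + d)%N.
have m0 : (0 < m)%N by rewrite /m; lia.
apply: (@le_trans _ _ (\sum_(w <- avwords m)
   (nfit_mean (decreasing t) m * (nocc t w)%:R +
    (m%:R / 2 * `|rldev R m w| + m%:R * (2 * d).+1%:R)))).
  have := sum_nocc_sq m tT; rewrite -(ler_nat R) !natr_sum.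
  under eq_bigr do rewrite natrX.
  move/le_trans; apply; rewrite big_seq [leRHS]big_seq.
  apply: ler_sum => w wA; have sw := size_avword wA.
  have Nm : (nocc t w)%:R <= m%:R :> R by rewrite ler_nat -sw nocc_le.
  have N0 : 0 <= (nocc t w)%:R :> R by [].
  set I := (if _ then _ else _).
  have Im : I%:R <= m%:R :> R.
    rewrite ler_nat /I; case: (decreasing t) => //.
    by rewrite /rlmins sw -[leqRHS]subn0 sum_bool_le.
  have Ix : I%:R <= nfit_mean (decreasing t) m + `|rldev R m w| / 2.
    rewrite /I /nfit_mean; case: (decreasing t); first by rewrite lerDl divr_ge0.
    by have := ler_norm (rldev R m w); rewrite {1}/rldev natrM; lra.
  rewrite natrM natrD mulrDr.
  have H1 := ler_wpM2r N0 Ix.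
  have H2 := ler_wpM2r (ler0n R (2 * d).+1) Im.
  have H3 := ler_wpM2l (normr_ge0 (rldev R m w)) Nm.
  by move: H1 H2 H3; rewrite mulrDl; lra.
rewrite !big_split /= -!mulr_sumr sum_const_avwords.
have -> := sum_nocc_mean tT p0.
have H1 := sum_abs_rldev h0 h1; rewrite -/m in H1.
have H2 := ler_wpM2l (ler0n R m) H1.
have H3 : nfit_mean (decreasing t) p <= nfit_mean (decreasing t) m.
  rewrite /nfit_mean; case: (decreasing t); rewrite ?ler_nat ?ler_pM2r //.
    by rewrite /m leq_addr.
  by rewrite ler_nat /m; lia.
have H4 : 0 <= nfit_mean (decreasing t) m by rewrite /nfit_mean; case: ifP.
have H5 := ler_wpM2l H4 (ler_wpM2r (ltW (avcountR_gt0 p)) H3).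
by move: H2 H5; rewrite -/m; set S := \sum_(_ <- _) _; lra.
Qed.
End OccurrenceMoments.

(** * Asymptotics of the variance bound *)
Section Limits.
Variable R : realType.
Local Notation c n := ((avcount n)%:R : R).
Local Open Scope classical_set_scope.

Lemma cvg_avcount_succ : c n.+1 / c n @[n --> \oo] --> (4 : R).
Proof.
have -> : (fun n => c n.+1 / c n) = (fun n => 4 - 6 * harmonic n.+1).
  apply/funext => n /=; have := avcount_rec n => /(congr1 (fun x => x%:R : R)).
  rewrite !natrM natrD natrM -(natr1 n.+1) -(natr1 n) => e.
  have c0 := avcountR_gt0 R n; have n0 : 0 <= n%:R :> R by [].
  have e' : c n.+1 = (4 * n%:R + 2) * c n / (n%:R + 1 + 1).
    by rewrite -e mulrAC divff ?mul1r //; lra.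
  by rewrite e'; field; apply/andP; split; lra.
rewrite -[X in _ --> X]subr0 -[X in _ --> _ - X](mulr0 6).
apply: cvgB; first exact: cvg_cst.
apply: cvgMl_tmp.
by have := @cvg_harmonic R; rewrite -cvg_shiftS.
Qed.

Lemma cvg_avcount_shift d : c (n + d) / c n @[n --> \oo] --> (4 ^+ d : R).
Proof.
elim: d => [|d IH].
  rewrite expr0 (_ : (fun n => _) = fun=> 1); first exact: cvg_cst.
  by apply/funext => n; rewrite addn0 divff // gt_eqF ?avcountR_gt0.
have -> : (fun n => c (n + d.+1) / c n) =
          (fun n => (c (n + d).+1 / c (n + d)) * (c (n + d) / c n)).
  by apply/funext => n; rewrite addnS mulrA divfK // gt_eqF ?avcountR_gt0.
rewrite exprS; apply: cvgM => //.
by have := cvg_avcount_succ; rewrite -(cvg_shiftn d).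
Qed.

(** A bound for the relative variance of the number of occurrences at size
    [p + d + d], see [prob_occurrences_le]. *)
Definition nocc_var_bound d p : R :=
  c p * c (p + d + d) / c (p + d) ^+ 2 - 1 +
  c (p + d + d) / c (p + d) *
    (2 * Num.sqrt (harmonic (p + d)%N) + (4 * (2 * d).+1)%:R * harmonic (p + d)%N).

Lemma cvg_nocc_var_bound d : nocc_var_bound d p @[p --> \oo] --> (0 : R).
Proof.
have r1 : c (n + d + d) / c (n + d) @[n --> \oo] --> (4 ^+ d : R).
  by have := @cvg_avcount_shift d; rewrite -(cvg_shiftn d).
have h0 : harmonic (n + d)%N @[n --> \oo] --> (0 : R).
  by have := @cvg_harmonic R; rewrite -(cvg_shiftn d).
have h1 : Num.sqrt (harmonic (n + d)%N) @[n --> \oo] --> (0 : R).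
  rewrite -[X in _ --> X](@sqrtr0 R).
  by apply: (cvg_comp _ _ h0); apply: sqrt_continuous.
have -> : nocc_var_bound d = (fun p => (c (p + d + d) / c (p + d)) *
      (c (p + d) / c p)^-1 - 1 +
      c (p + d + d) / c (p + d) *
    (2 * Num.sqrt (harmonic (p + d)%N) + (4 * (2 * d).+1)%:R * harmonic (p + d)%N)).
  apply/funext => p; rewrite /nocc_var_bound; congr (_ - 1 + _).
  have := avcountR_gt0 R p; have := avcountR_gt0 R (p + d) => a0 b0.
  by field; apply/andP; split; lra.
have -> : (0 : R) = 4 ^+ d * (4 ^+ d)^-1 - 1
    + 4 ^+ d * (2 * 0 + (4 * (2 * d).+1)%:R * 0).
  by rewrite !mulr0 addr0 mulr0 addr0 divff ?subrr // expf_neq0 // pnatr_eq0.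
apply: cvgD; first (apply: cvgB; last exact: cvg_cst); apply: cvgM => //.
  by apply: cvgV; rewrite ?expf_neq0 ?pnatr_eq0 //; apply: cvg_avcount_shift.
by apply: cvgD; apply: cvgMl_tmp.
Qed.
End Limits.

(** * Expectation and deviation under the uniform measure *)
Section Probability.
Variables (R : realType) (eta : 'S_3).

Lemma expect_avE n (X : 'S_n -> R) :
  expect_av eta X = (\sum_(s in avoiders eta n) X s) / #|avoiders eta n|%:R.
Proof.
rewrite /expect_av [in RHS]big_mkcond mulr_suml; apply: eq_bigr => s _.
rewrite /prob_av; case: ifP => sA.
  rewrite (_ : _ :&: _ = [set s]) ?cards1 ?mul1r 1?mulrC //.
  by apply/finset.setIidPr; rewrite finset.sub1set.
rewrite (_ : _ :&: _ = finset.set0) ?cards0 ?mul0r //.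
by apply/eqP; rewrite finset.setI_eq0 disjoint_sym disjoints1 sA.
Qed.

Lemma prob_av_ge0 n (A : {set 'S_n}) : 0 <= prob_av R eta A.
Proof. by rewrite divr_ge0. Qed.

Lemma chebyshev_av n (X : 'S_n -> R) (mu eps : R) :
  (0 < #|avoiders eta n|)%N -> 0 < mu -> 0 < eps -> expect_av eta X = mu ->
  prob_av R eta [set s | eps < `|X s / mu - 1|] <=
  (expect_av eta (fun s => X s ^+ 2) / mu ^+ 2 - 1) / eps ^+ 2.
Proof.
move=> a0 mu0 eps0 Emu; set a := #|avoiders eta n|%:R : R.
have a0' : 0 < a by rewrite ltr0n.
have sX : \sum_(s in avoiders eta n) X s = mu * a.
  by rewrite -Emu expect_avE divfK // gt_eqF.
have sX2 : \sum_(s in avoiders eta n) X s ^+ 2 =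
    expect_av eta (fun s => X s ^+ 2) * a.
  by rewrite expect_avE divfK // gt_eqF.
rewrite ler_pdivlMr ?exprn_gt0 // /prob_av -/a mulrAC ler_pdivrMr //.
have -> : (expect_av eta (fun s => X s ^+ 2) / mu ^+ 2 - 1) * a =
    \sum_(s in avoiders eta n) (X s / mu - 1) ^+ 2.
  transitivity (\sum_(s in avoiders eta n) (X s ^+ 2 * (mu ^+ 2)^-1 -
     X s * (2 / mu) + 1)).
    rewrite big_split sumrB -!mulr_suml sX sX2 sumr_const -/a -mulr_natl /=.
    by field; lra.
  by apply: eq_bigr => s _; field; lra.
rewrite -sum1_card natr_sum mulr_suml [leRHS](bigID (mem [set s | eps < `|X s / mu - 1|])) /=.
apply: ler_wpDr; first by apply: sumr_ge0 => s _; rewrite sqr_ge0.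
rewrite (eq_bigl _ _ (fun s => finset.in_setI s _ _)).
apply: ler_sum => s /andP[_]; rewrite inE mul1r => H.
by rewrite -[leRHS]real_normK ?num_real // ler_pXn2r ?nnegrE // ltW.
Qed.
End Probability.

(** * The laws of large numbers *)
Section LawsOfLargeNumbers.
Variables (R : realType) (eta : 'S_3) (tstar : forall k, 'S_k).
Hypothesis mod : modelled eta tstar.
Local Notation c n := ((avcount n)%:R : R).

Lemma expect_av_model d (tau : 'S_d.+1) : tau \in avoiders eta d.+1 ->
  exists2 t, t \in avwords d.+1 /\ decreasing t = (tau == tstar d.+1) &
    forall n (F : nat -> R), (0 < n)%N ->
      expect_av eta (fun s : 'S_n => F (occurrences tau s)) =
      (\sum_(w <- avwords n) F (nocc t w)) / c n.
Proof.
have [_ mod2] := mod; move=> /mod2[t tT H]; exists t => // n F n0.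
by rewrite expect_avE H (card_avoiders mod).
Qed.

Lemma expect_occurrences d m (tau : 'S_d.+1) :
  tau \in avoiders eta d.+1 -> (0 < m)%N ->
  expect_av eta (fun s : 'S_(m + d) => (occurrences tau s)%:R) =
  nfit_mean R (tau == tstar d.+1) m * c m / c (m + d).
Proof.
move=> /expect_av_model[t [tT dec] H] m0; rewrite H; last by lia.
by rewrite sum_nocc_mean // dec.
Qed.

Lemma nfit_mean_ge dec m : (0 < m)%N -> m.+1%:R / 2 <= nfit_mean R dec m.
Proof.
move=> m0; rewrite /nfit_mean; case: dec => //.
by rewrite ler_pdivrMr // -natrM ler_nat; lia.
Qed.

(** Chebyshev's inequality with the second moment bounded by [sum_nocc_sq_bound].
    Relative to the squared mean the main term is [c_p * c_N / c_(p + d) ^ 2], and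
    [nfit_mean_ge] makes the error terms of the order of [h], times [c_N / c_(p + d)]. *)
Lemma prob_occurrences_le d p N (tau : 'S_d.+1) (eps : R) :
  tau \in avoiders eta d.+1 -> (0 < p)%N -> 0 < eps -> N = (p + d + d)%N ->
  prob_av R eta [set s : 'S_N | eps < `|(occurrences tau s)%:R /
     expect_av eta (fun s' : 'S_N => (occurrences tau s')%:R : R) - 1|] <=
  nocc_var_bound R d p / eps ^+ 2.
Proof.
move=> tauA p0 eps0 ->{N}; have [t [tT dec] H] := expect_av_model tauA.
set m := (p + d)%N; have m0 : (0 < m)%N by rewrite /m; lia.
have E1 := expect_occurrences tauA m0.
have E2 := H (m + d)%N (fun x => x%:R ^+ 2); rewrite addn_gt0 m0 in E2.
have {}E2 := E2 isT.
rewrite -dec in E1; set M := nfit_mean R (decreasing t) m in E1.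
have M1 : m.+1%:R / 2 <= M := nfit_mean_ge _ m0.
have k0 : 0 < m.+1%:R :> R by rewrite ltr0n.
have M0 : 0 < M by lra.
have cm := avcountR_gt0 R m; have cn := avcountR_gt0 R (m + d); have cp := avcountR_gt0 R p.
have mu0 : 0 < M * c m / c (m + d) by rewrite divr_gt0 ?mulr_gt0.
rewrite E1; apply: le_trans (chebyshev_av _ mu0 eps0 E1) _.
  by rewrite (card_avoiders mod) ?avcount_gt0 // addn_gt0 m0.
rewrite ler_pM2r ?invr_gt0 ?exprn_gt0 // /nocc_var_bound -/m E2.
have hpos : 0 < harmonic m :> R by rewrite /harmonic invr_gt0.
set h := Num.sqrt (harmonic m).
have h0 : 0 < h by rewrite sqrtr_gt0.
have h1 : h ^+ 2 * m.+1%:R = 1 by rewrite sqr_sqrtr ?ltW // mulVf // gt_eqF.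
have B := sum_nocc_sq_bound tT p0 h0 h1; rewrite -/m -/M in B.
set S := \sum_(_ <- _) _ in B *.
set K := m.+1%:R * h / 2 + (2 * d).+1%:R in B.
have K0 : 0 <= K by rewrite addr_ge0 // divr_ge0 // mulr_ge0 // ltW.
have -> : S / c (m + d) / (M * c m / c (m + d)) ^+ 2 =
          S * (c (m + d) / (M * c m) ^+ 2) by field; repeat (apply/andP; split); lra.
have q0 : 0 < c (m + d) / (M * c m) ^+ 2 by rewrite divr_gt0 ?exprn_gt0 ?mulr_gt0.
have B1 := ler_wpM2r (ltW q0) B.
have e1 : (M ^+ 2 * c p + m%:R * c m * K) * (c (m + d) / (M * c m) ^+ 2) =
   c p * c (m + d) / c m ^+ 2 + (c (m + d) / c m) * (m%:R * K / M ^+ 2).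
  by field; repeat (apply/andP; split); lra.
have B2 : m%:R * K / M ^+ 2 <= 2 * h + (4 * (2 * d).+1)%:R * harmonic m.
  have -> : 2 * h + (4 * (2 * d).+1)%:R * harmonic m = m.+1%:R * K / (m.+1%:R / 2) ^+ 2.
    by rewrite /K natrM /=; field; lra.
  apply: ler_pM.
  - by rewrite mulr_ge0.
  - by rewrite invr_ge0 exprn_ge0 // ltW.
  - by rewrite ler_wpM2r // ler_nat.
  - rewrite lef_pV2 ?posrE ?exprn_gt0 ?divr_gt0 //.
    by rewrite ler_pXn2r // nnegrE ltW // divr_gt0.
have B3 := ler_wpM2l (ltW (divr_gt0 cn cm)) B2.
by rewrite e1 in B1; lra.
Qed.

Lemma wlln_occurrences d (tau : 'S_d.+1) : tau \in avoiders eta d.+1 ->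
  cvg_in_prob_av eta
    (fun n (s : 'S_n) => (occurrences tau s)%:R /
       expect_av eta (fun s' : 'S_n => (occurrences tau s')%:R : R)) 1.
Proof.
move=> tauA eps eps0; rewrite -(cvg_shiftn (d + d).+1).
apply: (@squeeze_cvgr _ _ _ _ (fun=> 0) (fun n => nocc_var_bound R d n.+1 / eps ^+ 2)).
- apply: nearW => n; rewrite prob_av_ge0 /=.
  by apply: prob_occurrences_le => //; lia.
- exact: cvg_cst.
- rewrite -[X in (_ --> X)%classic](mul0r (eps ^+ 2)^-1).
  apply: cvgMr_tmp.
  by have := @cvg_nocc_var_bound R d; rewrite -cvg_shiftS.
Qed.

Lemma expect_av_sum n (I : finType) (P : pred I) (X : I -> 'S_n -> R) :
  expect_av eta (fun s => \sum_(i | P i) X i s) =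
  \sum_(i | P i) expect_av eta (X i).
Proof.
rewrite /expect_av [RHS]exchange_big; apply: eq_bigr => s _.
by rewrite mulr_sumr.
Qed.

Lemma prob_av_sub_sum n (I : finType) (P : pred I) (A : {set 'S_n})
    (B : I -> {set 'S_n}) :
  (forall s, s \in A -> exists2 i, P i & s \in B i) ->
  prob_av R eta A <= \sum_(i | P i) prob_av R eta (B i).
Proof.
move=> cover; rewrite /prob_av -mulr_suml ler_wpM2r // -natr_sum ler_nat.
under eq_bigr do rewrite -sum1_card.
rewrite -sum1_card [leqRHS](exchange_big_dep (mem (avoiders eta n))) /=; last first.
  by move=> i s _; rewrite finset.in_setI => /andP[].
rewrite big_mkcond [leqRHS]big_mkcond; apply: leq_sum => s _.
rewrite finset.in_setI; case: (boolP (s \in avoiders eta n)) => //= sA.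
case: ifP => // /cover[i Pi Bi]; rewrite (bigD1 i) //=.
by rewrite Pi finset.in_setI sA.
Qed.

Lemma expect_occurrences_gt0 d n (tau : 'S_d.+1) :
  tau \in avoiders eta d.+1 -> (d < n)%N ->
  0 < expect_av eta (fun s : 'S_n => (occurrences tau s)%:R : R).
Proof.
move=> tauA dn.
have -> : n = ((n - d) + d)%N by lia.
have m0 : (0 < n - d)%N by lia.
rewrite (expect_occurrences tauA m0) divr_gt0 ?mulr_gt0 ?avcountR_gt0 //.
by apply: lt_le_trans (nfit_mean_ge _ m0); rewrite divr_gt0.
Qed.

Lemma occurrences_allE k n (s : 'S_n) : (occurrences_all eta k s)%:R =
  \sum_(tau in avoiders eta k) (occurrences tau s)%:R :> R.
Proof. exact: natr_sum. Qed.

(** If the count of every [tau] differs from its mean by at most [eps] times this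
    positive mean, then the same holds for the sum over [tau]; hence a union
    bound. *)
Lemma wlln_occurrences_all d :
  cvg_in_prob_av eta
    (fun n (s : 'S_n) => (occurrences_all eta d.+1 s)%:R /
       expect_av eta (fun s' : 'S_n => (occurrences_all eta d.+1 s')%:R : R)) 1.
Proof.
move=> eps eps0.
pose pr (tau : 'S_d.+1) n := prob_av R eta [set s : 'S_n |
  eps < `|(occurrences tau s)%:R /
       expect_av eta (fun s' : 'S_n => (occurrences tau s')%:R : R) - 1|].
apply: (@squeeze_cvgr _ _ _ _ (fun=> 0)
  (fun n => \sum_(tau in avoiders eta d.+1) pr tau n)).
- exists d.+1 => // n /= dn; rewrite prob_av_ge0 /=.
  apply: prob_av_sub_sum => s; rewrite inE => Hs; apply/exists_inP.
  apply: contraLR Hs => /exists_inPn small; rewrite -leNgt.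
  pose e (tau : 'S_d.+1) :=
    expect_av eta (fun s' : 'S_n => (occurrences tau s')%:R : R).
  have Ee : expect_av eta (fun s' : 'S_n => (occurrences_all eta d.+1 s')%:R : R) =
      \sum_(tau in avoiders eta d.+1) e tau.
    rewrite -expect_av_sum; congr expect_av; apply/funext => s'.
    exact: occurrences_allE.
  have e0 tau : tau \in avoiders eta d.+1 -> 0 < e tau.
    by move=> tA; apply: expect_occurrences_gt0.
  have E0 : 0 < \sum_(tau in avoiders eta d.+1) e tau.
    have [starA _] := mod; rewrite (bigD1 (tstar d.+1)) //=.
    by apply: ltr_pwDl; [exact: e0 (starA _) | apply: sumr_ge0 => tau /andP[/e0/ltW]].
  rewrite Ee -(@ler_pM2r _ (\sum_(tau in avoiders eta d.+1) e tau)) //.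
  rewrite -[X in _ * X <= _]gtr0_norm // -normrM mulrBl divfK ?gt_eqF //.
  rewrite mul1r occurrences_allE -sumrB.
  apply: le_trans (ler_norm_sum _ _ _) _; rewrite mulr_sumr.
  apply: ler_sum => tau tA; have et := e0 _ tA.
  have := small tau tA; rewrite inE -leNgt -/(e tau) => /(ler_wpM2r (ltW et)).
  apply: le_trans; rewrite -[X in _ <= _ * X]gtr0_norm //.
  by rewrite -normrM mulrBl divfK ?gt_eqF // mul1r.
- exact: cvg_cst.
suff : (\sum_(tau in avoiders eta d.+1) pr tau n @[n --> \oo] -->
        \sum_(tau in avoiders eta d.+1) (0 : R))%classic by rewrite big1_eq.
apply: cvg_big => [|tau tA]; first exact: add_continuous.
exact: wlln_occurrences.
Qed.
End LawsOfLargeNumbers.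

(** * Exact means and convergence in probability *)
Theorem theorem1 (R : realType) (eta : 'S_3)
    (heta : one_line eta \in
      [:: [:: 1; 3; 2]; [:: 2; 1; 3]; [:: 2; 3; 1]; [:: 3; 1; 2]]%N) :
  (* (i) *)
  ((forall (k n : nat) (tau : 'S_k),
      (2 <= k)%N -> (k <= n)%N -> tau \in avoiders eta k ->
      expect_av eta (fun s : 'S_n => (occurrences tau s)%:R : R) =
        if tau != tau_star eta k then
          (n - k + 2)%:R * catalan R (n - k + 1) / (2 * catalan R n)
        else
          (n - k + 3)%:R * catalan R (n - k + 2) / (2 * catalan R n)
          - (n - k + 2)%:R * catalan R (n - k + 1) / catalan R n) /\
   (forall (k : nat) (tau : 'S_k),
      (2 <= k)%N -> tau \in avoiders eta k ->
      cvg_in_prob_av eta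
        (fun n (s : 'S_n) => (occurrences tau s)%:R /
           expect_av eta (fun s' : 'S_n => (occurrences tau s')%:R : R)) 1)) /\
  (* (ii) *)
  ((forall k n : nat,
      (2 <= k)%N -> (k <= n)%N ->
      expect_av eta (fun s : 'S_n => (occurrences_all eta k s)%:R : R) =
        catalan R (n - k + 1) / (2 * catalan R n)
        * ((n - k + 2)%:R * catalan R k + (n - k)%:R)) /\
   (forall k : nat, (2 <= k)%N ->
      cvg_in_prob_av eta
        (fun n (s : 'S_n) => (occurrences_all eta k s)%:R /
           expect_av eta
             (fun s' : 'S_n => (occurrences_all eta k s')%:R : R)) 1)).
Proof.
have mod := avoiders_modelled heta.
(* [j.+1 = n - k + 1] is the size after contraction of an occurrence. *)
have mean d j (tau : 'S_d.+1) : tau \in avoiders eta d.+1 ->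
    expect_av eta (fun s : 'S_(j.+1 + d) => (occurrences tau s)%:R : R) =
    (if tau == tau_star eta d.+1 then j.+1%:R else j.+2%:R / 2) *
      ((avcount j.+1)%:R / (avcount (j.+1 + d))%:R).
  by move=> tauA; rewrite (expect_occurrences R mod tauA) // /nfit_mean mulrA.
split; split.
- case=> [//|d] n tau _ dn tauA; have [j ->] : exists j, n = (j.+1 + d)%N.
    by exists (n - d.+1)%N; lia.
  have -> : (j.+1 + d - d.+1 = j)%N by lia.
  rewrite mean // !catalan_avcount !addn1 !addn2 !addn3.
  have cn := avcountR_gt0 R (j.+1 + d).
  (* Expresses [C_(n - k + 2)], which only enters for [tau_star], by
     [C_(n - k + 1)]. *)
  have e : j.+3%:R * (avcount j.+2)%:R = (4 * j.+1 + 2)%:R * (avcount j.+1)%:R :> R.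
    by rewrite -!natrM avcount_rec.
  case: eqP => _ /=; last by field; lra.
  rewrite e natrD natrM -(natr1 j.+1) -(natr1 j).
  by field; lra.
- by case=> [//|d] tau _ tauA; exact: (@wlln_occurrences R eta _ mod).
- case=> [//|d] n _ dn; have [j ->] : exists j, n = (j.+1 + d)%N.
    by exists (n - d.+1)%N; lia.
  have -> : (j.+1 + d - d.+1 = j)%N by lia.
  rewrite !catalan_avcount !addn1 !addn2.
  rewrite (_ : expect_av eta _ = \sum_(tau in avoiders eta d.+1)
     expect_av eta (fun s : 'S_(j.+1 + d) => (occurrences tau s)%:R : R));
    last first.
    rewrite -expect_av_sum; congr expect_av; apply/funext => s.
    exact: occurrences_allE.
  have [starA _] := mod.
  (* [C_k] is the number of blocks: one of them is [tau_star], and the others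
     share the same mean. *)
  have := card_avoiders mod (ltn0Sn d); rewrite -sum1_card => cardA.
  have {cardA} := congr1 (fun x => x%:R : R) cardA; rewrite natr_sum.
  rewrite (bigD1 (tau_star eta d.+1)) //= => <-.
  rewrite (bigD1 (tau_star eta d.+1)) //= mean // eqxx.
  under eq_bigr => tau /andP[tA /negPf ne] do rewrite mean // ne -[_ * _]mul1r.
  rewrite -mulr_suml.
  move: (\sum_(_ | _) _) (avcountR_gt0 R (j.+1 + d)) => q cn.
  rewrite -(natr1 j.+1) -(natr1 j).
  by field; lra.
- by case=> [//|d] _; exact: (@wlln_occurrences_all R eta _ mod).
Qed.
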